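(* Let $p\ge 1$ be a real number. Let $H$ be a finitely generated amenable group whose $\ell^p$-isoperimetric profile $j_{p,H}$ satisfies Assumption $(\star)$. Then the $\ell^p$-isoperimetric profile $j_{p,\mathsf{Shuffler}(H)}$ of the lampshuffler group $\mathsf{Shuffler}(H)$ satisfies $$j_{p,H}\left(\frac{\ln(x)}{\ln(\ln(x))}\right)\preccurlyeq j_{p,\mathsf{Shuffler}(H)}(x)\preccurlyeq j_{1,H}(\ln(x)).$$
   Context: Isoperimetric profile: for a finitely generated group $G$ with finite generating set $S_G$ and a real $p\ge 1$, $j_{p,G}(x)=\sup \|f\|_p/\|\nabla f\|_p$, the supremum being over (nonzero) functions $f\colon G\to\mathbb{R}_+$ with $|\mathrm{supp}\, f|\le x$, where $\mathrm{supp}\, f=\{g: f(g)\neq 0\}$ and $\|\nabla f\|_p^p=\sum_{g\in G,\,s\in S_G}|f(g)-f(gs)|^p$. Up to the relation $\simeq$ below it does not depend on $S_G$. Asymptotic comparison: for non-decreasing functions, $f\preccurlyeq g$ means that there is $C>0$ such that $f(x)=O(g(Cx))$ as $x\to+\infty$; $f\simeq g$ means $f\preccurlyeq g$ and $g\preccurlyeq f$. Expressions are considered for $x$ large enough. Assumption $(\star)$: a non-decreasing function $h$ satisfies Assumption $(\star)$ if for every $C>0$, $h(Cx)=O(h(x))$ as $x\to+\infty$. Lampshuffler: $\mathsf{Shuffler}(H)=\mathsf{FSym}(H)\rtimes H$, where $\mathsf{FSym}(H)$ is the group of finitely supported bijections $H\to H$ and $H$ acts by $(h\cdot\sigma)(x)=h\sigma(h^{-1}x)$.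 It is finitely generated when $H$ is. *)

(* Defs.v *)
From HB Require Import structures.
From mathcomp Require Import all_boot all_order all_algebra finmap.
From mathcomp Require Import all_classical all_reals all_analysis.

Set Implicit Arguments.
Unset Strict Implicit.
Unset Printing Implicit Defensive.

Import Order.TTheory GRing.Theory Num.Theory.
Import numFieldNormedType.Exports.

Local Open Scope classical_set_scope.
Local Open Scope ring_scope.

Section FinSym.
Variable T : Type.

Definition finitary_bij (f : T -> T) : Prop :=
  bijective f /\ finite_set [set x | f x <> x].

Record finSym := FinSym {
  finSym_fun :> T -> T ;
  finSymP : finitary_bij finSym_fun }.

HB.instance Definition _ := gen_eqMixin finSym.
HB.instance Definition _ := gen_choiceMixin finSym.

Lemma finSym_ext (s t : finSym) : s =1 t -> s = t.
Proof.
case: s t => [f fP] [g gP] /= /funext fg.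
by case: _ / fg gP => gP; rewrite (Prop_irrelevance fP gP).
Qed.

Lemma finitary_bij_id : finitary_bij id.
Proof.
split; first by exists id.
by rewrite (_ : [set x | _] = set0) //; apply/seteqP; split=> x /=.
Qed.

Lemma finitary_bij_comp (f g : T -> T) :
  finitary_bij f -> finitary_bij g -> finitary_bij (f \o g).
Proof.
move=> [bf ff] [bg fg]; split; first exact: bij_comp.
apply: (@sub_finite_set _ _ ([set x | f x <> x] `|` [set x | g x <> x])).
  move=> x /= fgx; case: (pselect (g x = x)) => [gx|]; last by right.
  by left; move: fgx; rewrite gx.
by rewrite finite_setU.
Qed.

Lemma finitary_bij_can (f g : T -> T) :
  cancel f g -> cancel g f -> finitary_bij f -> finitary_bij g.
Proof.
move=> fK gK [_ ff]; split; first by exists f.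
by apply: sub_finite_set ff => x /= gx fx; apply: gx; rewrite -{1}fx fK.
Qed.

Lemma finSym_inv_ex (s : finSym) : exists g : T -> T, cancel s g /\ cancel g s.
Proof. by case: s => f [[g fK gK] ?]; exists g. Qed.

Definition finSym_inv_fun (s : finSym) : T -> T := sval (cid (finSym_inv_ex s)).

Lemma finSym_funK (s : finSym) : cancel s (finSym_inv_fun s).
Proof. exact: (svalP (cid (finSym_inv_ex s))).1. Qed.

Lemma finSym_invK (s : finSym) : cancel (finSym_inv_fun s) s.
Proof. exact: (svalP (cid (finSym_inv_ex s))).2. Qed.

Definition finSym_one : finSym := FinSym finitary_bij_id.

Definition finSym_mul (s t : finSym) : finSym :=
  FinSym (finitary_bij_comp (finSymP s) (finSymP t)).

Definition finSym_inv (s : finSym) : finSym :=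
  FinSym (finitary_bij_can (@finSym_funK s) (@finSym_invK s) (finSymP s)).

Lemma finSym_mulA : associative finSym_mul.
Proof. by move=> s t u; apply: finSym_ext. Qed.

Lemma finSym_mul1 : left_id finSym_one finSym_mul.
Proof. by move=> s; apply: finSym_ext. Qed.

Lemma finSym_mulr1 : right_id finSym_one finSym_mul.
Proof. by move=> s; apply: finSym_ext. Qed.

Lemma finSym_mulV : left_inverse finSym_one finSym_inv finSym_mul.
Proof. by move=> s; apply: finSym_ext => x /=; rewrite finSym_funK. Qed.

Lemma finSym_mulrV : right_inverse finSym_one finSym_inv finSym_mul.
Proof. by move=> s; apply: finSym_ext => x /=; rewrite finSym_invK. Qed.

HB.instance Definition _ := isGroup.Build finSym
  finSym_mulA finSym_mul1 finSym_mulr1 finSym_mulV finSym_mulrV.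

End FinSym.

Section Shuffler.
Variable H : groupType.

Lemma finSym_act_subproof (h : H) (s : finSym H) :
  finitary_bij (fun x => h * s (h^-1 * x))%g.
Proof.
split.
  exists (fun x => h * finSym_inv_fun s (h^-1 * x))%g => x /=.
    by rewrite mulKg finSym_funK mulVKg.
  by rewrite mulKg finSym_invK mulVKg.
apply: (@sub_finite_set _ _ ((fun x => h * x)%g @` [set x | s x <> x])).
  move=> x /= sx; exists (h^-1 * x)%g; last by rewrite mulVKg.
  by move=> hx; apply: sx; rewrite hx mulVKg.
by apply: finite_image; case: (finSymP s).
Qed.

Definition finSym_act (h : H) (s : finSym H) : finSym H := FinSym (finSym_act_subproof h s).

(* A dedicated record, because the product type [finSym H * H] already carries
   the structure of a direct product of groups. *)
Record shuffler := Shuffler {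
  shuffler_perm : finSym H ;
  shuffler_cursor : H }.

HB.instance Definition _ := gen_eqMixin shuffler.
HB.instance Definition _ := gen_choiceMixin shuffler.

Definition shuffler_one : shuffler := Shuffler 1%g 1%g.

Definition shuffler_mul (a b : shuffler) : shuffler :=
  Shuffler (shuffler_perm a * finSym_act (shuffler_cursor a) (shuffler_perm b))%g
           (shuffler_cursor a * shuffler_cursor b)%g.

Definition shuffler_inv (a : shuffler) : shuffler :=
  Shuffler (finSym_act (shuffler_cursor a)^-1%g (shuffler_perm a)^-1%g)
           (shuffler_cursor a)^-1%g.

Lemma finSym_act1 (s : finSym H) : finSym_act 1%g s = s.
Proof. by apply: finSym_ext => x /=; rewrite invg1 !mul1g. Qed.

Lemma finSym_actM (h k : H) (s : finSym H) :
  finSym_act (h * k)%g s = finSym_act h (finSym_act k s).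
Proof. by apply: finSym_ext => x /=; rewrite invgM !mulgA. Qed.

Lemma finSym_act_mul (h : H) (s t : finSym H) :
  finSym_act h (s * t)%g = (finSym_act h s * finSym_act h t)%g.
Proof. by apply: finSym_ext => x /=; rewrite mulKg. Qed.

Lemma finSym_act_one (h : H) : finSym_act h 1%g = 1%g.
Proof. by apply: finSym_ext => x /=; rewrite mulVKg. Qed.

Lemma shuffler_mulA : associative shuffler_mul.
Proof.
by move=> a b c; rewrite /shuffler_mul /= finSym_act_mul finSym_actM !mulgA.
Qed.

Lemma shuffler_mul1 : left_id shuffler_one shuffler_mul.
Proof. by case=> s h; rewrite /shuffler_mul /= finSym_act1 !mul1g. Qed.

Lemma shuffler_mulr1 : right_id shuffler_one shuffler_mul.
Proof. by case=> s h; rewrite /shuffler_mul /= finSym_act_one !mulg1. Qed.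

Lemma shuffler_mulV : left_inverse shuffler_one shuffler_inv shuffler_mul.
Proof.
by case=> s h; rewrite /shuffler_mul /= -finSym_act_mul !mulVg finSym_act_one.
Qed.

Lemma shuffler_mulrV : right_inverse shuffler_one shuffler_inv shuffler_mul.
Proof.
by case=> s h; rewrite /shuffler_mul /= -finSym_actM !mulgV finSym_act1 mulgV.
Qed.

HB.instance Definition _ := isGroup.Build shuffler
  shuffler_mulA shuffler_mul1 shuffler_mulr1 shuffler_mulV shuffler_mulrV.

End Shuffler.

(* The only subgroup containing S is G itself. *)
Definition generates (G : groupType) (S : {fset G}) : Prop :=
  forall A : set G, [set` S] `<=` A -> A 1%g ->
    (forall g h, A g -> A h -> A (g * h)%g) -> (forall g, A g -> A g^-1%g) ->
  A = setT.

(* Følner's condition; right translates are used, in accordance with the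
   gradient f(g) - f(gs) below. *)
Definition amenable (R : realType) (G : groupType) : Prop :=
  forall (K : {fset G}) (e : R), 0 < e ->
  exists2 F : {fset G}, F != fset0 &
    forall k, k \in K ->
      let Fk := [fset (g * k)%g | g in F]%fset in
      #|` (Fk `\` F) `|` (F `\` Fk)|%fset%:R <= e * #|` F|%:R.

Section Profile.
Variable R : realType.

Definition lpnorm (p : R) (I : choiceType) (D : set I) (u : I -> R) : \bar R :=
  ((\esum_(i in D) (`|u i| `^ p)%:E) `^ p^-1)%E.

Variable G : groupType.

Definition supp (f : G -> R) : set G := [set g | f g != 0].

Definition gradnorm (p : R) (S : {fset G}) (f : G -> R) : \bar R :=
  lpnorm p ([set: G] `*` [set` S]) (fun gs => f gs.1 - f (gs.1 * gs.2)%g).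

(* The values are extended reals with r / 0 = +oo for r > 0: the supremum is
   +oo when the gradient of a non-zero admissible f vanishes, which happens
   only if G is finite.  It is -oo for x < 1, where no f is admissible. *)
Definition profile (p : R) (S : {fset G}) (x : R) : \bar R :=
  ereal_sup [set (lpnorm p [set: G] f / gradnorm p S f)%E | f in
    [set f : G -> R | [/\ forall g, 0 <= f g,
                          exists g, f g != 0,
                          finite_set (supp f) &
                          #|` fset_set (supp f)|%:R <= x]]].

End Profile.

Section Asymptotics.
Variable R : realType.
Implicit Types f g h : R -> \bar R.

(* f(x) = O(g(x)) as x -> +oo, for functions with extended real values. *)
Definition bigO_pinfty f g : Prop :=
  exists2 M : R, 0 < M & \forall x \near +oo, (`|f x| <= M%:E * `|g x|)%E.

Definition preceq f g : Prop :=
  exists2 C : R, 0 < C & bigO_pinfty f (fun x => g (C * x)).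

Definition assumption_star h : Prop :=
  forall C : R, 0 < C -> bigO_pinfty (fun x => h (C * x)) h.

End Asymptotics.

(* Main.v *)
Require Import Defs.
From mathcomp Require Import all_boot all_order all_algebra finmap.
From mathcomp Require Import all_classical all_reals all_analysis.
From mathcomp Require Import zify ring lra.

(* Upper bound.  Replacing f by f^p and peeling off level sets reduces the claim
   to finite sets F of Shuffler(H), seen as families of fibres F_s = {h : (s, h) in F}
   indexed by permutations s.  If F has small boundary and |F| <= x, the fibres of
   size at most ln x contribute little, since they have large boundary in H; so
   most of F lies over permutations s having at least k = ln x cursor positions.
   A minimal set W of such permutations with small boundary is stable under a fixed
   proportion of the moves s -> s (h hg), where h is in F_s and g in a fixed set of
   8q elements.  Revealing the values of a permutation one after the other then
   gives |W| >= q^(k/8).  As q is arbitrary this exceeds x; the freedom in q is what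
   yields ln x, and not merely a multiple of it, as the argument of j_{1,H}.

   Lower bound.  A function f on H lifts to f(h) 1[s is supported in A], where A
   is a bounded neighbourhood of supp f containing the support of every lamp move
   made from a point of supp f; all energies are multiplied by the same factor. *)

Set Implicit Arguments.
Unset Strict Implicit.
Unset Printing Implicit Defensive.

Import Order.TTheory GRing.Theory Num.Theory.
Import numFieldNormedType.Exports.

Local Open Scope ring_scope.

(** * Sets of permutations stable under many transpositions *)

Lemma card_fset_filter (T : choiceType) (A : {fset T}) (P : pred T) :
  #|` [fset x in A | P x]%fset| = (\sum_(x <- A) P x)%N.
Proof.
rewrite card_fset_sum1 big_fset /= big_mkcond /=.
by apply: eq_bigr => x _; case: (P x).
Qed.

Lemma sum_eq_mem (T : choiceType) (A : {fset T}) (x : T) :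
  (\sum_(y <- A) (y == x) = (x \in A))%N.
Proof.
rewrite -card_fset_filter; case: (boolP (x \in A)) => xA.
  rewrite (_ : [fset _ in _ | _]%fset = [fset x]%fset) ?cardfs1 //.
  apply/fsetP => y; rewrite !inE /=.
  by case: eqP => [->|]; rewrite ?andbF ?xA.
apply/eqP; rewrite cardfs_eq0; apply/eqP/fsetP => y; rewrite !inE /=.
by case: eqP => [->|]; rewrite ?andbF // (negbTE xA).
Qed.

Lemma sum_inj_le (T U : choiceType) (A : {fset T}) (B : {fset U}) (P : pred T)
    (f : T -> U) :
  {in [pred x | (x \in A) && P x] &, injective f} ->
  (forall x, x \in A -> P x -> f x \in B) ->
  (\sum_(x <- A) P x <= #|` B|)%N.
Proof.
move=> fi fB; rewrite -card_fset_filter.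
suff <- : #|` [fset f x | x in [fset x in A | P x]]%fset| =
          #|` [fset x in A | P x]%fset|.
  apply: fsubset_leq_card; apply/fsubsetP => y /imfsetP[x /=].
  by rewrite !inE /= => /andP[xA Px] ->; apply: fB.
by apply: card_in_imfset => x y; rewrite !inE /= => ? ?; apply: fi; rewrite inE.
Qed.

Lemma leq_sum_fset (T : choiceType) (A : {fset T}) (u v : T -> nat) :
  (forall x, x \in A -> u x <= v x)%N ->
  (\sum_(x <- A) u x <= \sum_(x <- A) v x)%N.
Proof. by move=> uv; rewrite !big_seq; apply: leq_sum. Qed.

(** [c] injects the points counted on the left into those counted on the right. With [c] a lamp
    move, this reverses the direction in which edges are counted. *)
Lemma sum_involution_le (T : choiceType) (A : {fset T}) (c : T -> T)
    (P Q : pred T) : involutive c ->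
  (\sum_(x <- A) [&& P x, c x \in A & Q (c x)] <=
   \sum_(x <- A) [&& Q x, c x \in A & P (c x)])%N.
Proof.
move=> cK; rewrite -[leqRHS]card_fset_filter; apply: (sum_inj_le (f := c)).
  by move=> x y _ _ /(can_inj cK).
by move=> x xA /and3P[Px cA Qc]; rewrite !inE /= cA Qc cK xA Px.
Qed.

(** * Transpositions and branching sets of permutations *)

Definition swap (T : eqType) (x y z : T) : T :=
  if z == x then y else if z == y then x else z.

Lemma swapK (T : eqType) (x y : T) : involutive (swap x y).
Proof.
move=> z; rewrite /swap; have [->|zx] := eqVneq z x.
  by rewrite eqxx; case: eqP.
by have [->|zy] := eqVneq z y; rewrite ?eqxx // (negbTE zx) (negbTE zy).
Qed.

Lemma swapL (T : eqType) (x y : T) : swap x y x = y.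
Proof. by rewrite /swap eqxx. Qed.

Lemma swapD (T : eqType) (x y z : T) : z != x -> z != y -> swap x y z = z.
Proof. by rewrite /swap => /negbTE-> /negbTE->. Qed.

Lemma finitary_swap (T : eqType) (x y : T) : finitary_bij (swap x y).
Proof.
split; first by exists (swap x y); apply: swapK.
apply: (@sub_finite_set _ _ [set x; y]%classic); last exact: finite_set2.
move=> z /=; rewrite /swap; case: eqP => [->|_]; first by left.
by case: eqP => [->|_]; first by right.
Qed.

Definition transp (T : eqType) (x y : T) : finSym T := FinSym (finitary_swap x y).

Lemma transpK (T : eqType) (x y : T) : (transp x y * transp x y)%g = 1%g.
Proof. by apply: finSym_ext => z /=; rewrite swapK. Qed.

Lemma finSym_inj (T : Type) (s : finSym T) : injective s.
Proof. exact: (can_inj (@finSym_funK T s)). Qed.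

(* Positions are revealed one at a time, in an order that depends on what has
   been revealed; the resulting decision tree branches at least q times along
   M levels, and its leaves are classes of a partition of W. *)
Lemma leq_exp_of_branching (T : choiceType) (W : {fset finSym T}) (q M : nat) :
  W != fset0 ->
  (forall s (D : {fset T}), s \in W -> (#|` D| < M)%N ->
    exists h (Q : {fset T}), [/\ h \notin D, (q <= #|` Q|)%N &
      forall y, y \in Q -> y \notin D /\ (s * transp h y)%g \in W]) ->
  (q ^ M <= #|` W|)%N.
Proof.
move=> /fset0Pn[s0 s0W] branch.
pose cyl (D : {fset T}) (s : finSym T) :=
  [pred t : finSym T | all (fun h => t h == s h) D].
(* Induction on the number [m] of levels left: at least [q ^ m] elements of [W] agree with [s] on
   the revealed positions [D]. *)
have key m (D : {fset T}) s : (#|` D| + m <= M)%N -> s \in W ->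
    (q ^ m <= \sum_(t <- W) cyl D s t)%N.
  elim: m D s => [|m IH] D s.
    rewrite addn0 expn0 => _ sW; rewrite (big_fsetD1 s) //=.
    by rewrite (_ : all _ _) //; apply/allP.
  rewrite addnS => DM sW.
  have [|h [Q [hD qQ HQ]]] := branch s D sW; first by apply: leq_trans DM; rewrite ltnS leq_addr.
  apply: (@leq_trans (\sum_(y <- Q) \sum_(t <- W) cyl (h |` D)%fset (s * transp h y)%g t)).
    apply: (@leq_trans (\sum_(y <- Q) q ^ m)); last first.
      apply: leq_sum_fset => y yQ; apply: IH; last by have [] := HQ y yQ.
      by rewrite cardfsU1 hD add1n addSn.
    by rewrite big_const_seq count_predT iter_addn_0 mulnC expnS leq_mul2r qQ orbT.
  (* The cylinders for different [y] are disjoint: [s * transp h y] sends [h] to [s y], so [t]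
     determines [y]. They all lie in the cylinder of [s], since neither [h] nor [y] is in [D]. *)
  rewrite exchange_big /=; apply: leq_sum_fset => t tW.
  case: (boolP (all _ D)) => [/allP tD|tD].
    apply: (@leq_trans (\sum_(y <- Q) (y == finSym_inv s (t h)))).
      apply: leq_sum_fset => y yQ; case: (boolP (all _ _)) => // /allP /(_ h).
      by rewrite fset1U1 /= swapL => /(_ isT)/eqP ->; rewrite finSym_funK eqxx.
    by rewrite sum_eq_mem; case: (_ \in _).
  rewrite big_seq big1 // => y yQ; case: (boolP (all _ _)) => // /allP td.
  case/allP: tD => z zD; have := td z; rewrite !inE zD orbT /= swapD //.
  - by move=> ->.
  - by apply: contraNneq hD => <-.
  - by have [yD _] := HQ y yQ; apply: contraNneq yD => <-.
have := key M fset0 s0; rewrite cardfs0 add0n leqnn => /(_ isT s0W).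
move/leq_trans; apply; rewrite card_fset_sum1.
by apply: leq_sum_fset => t _; case: (cyl _ _ _).
Qed.

(** * Lamp moves and the fibres of a finite set *)

Definition lampmove (H : groupType) (g : H) : shuffler H := Shuffler (transp 1%g g) 1%g.

(** The cursor [h] translates the transposition of [1] and [g] into that of [h] and [h * g]. *)
Lemma mul_lampmove (H : groupType) (a : shuffler H) (g : H) :
  (a * lampmove g)%g =
  Shuffler (shuffler_perm a * transp (shuffler_cursor a) (shuffler_cursor a * g))%g
           (shuffler_cursor a).
Proof.
case: a => s h; congr Shuffler; rewrite /= ?mulg1 //; congr (_ * _)%g.
apply: finSym_ext => x /=; rewrite /swap (can2_eq (mulVKg _) (mulKg _)) mulg1.
rewrite (can2_eq (mulVKg _) (mulKg _)).
by case: eqP => // _; case: eqP => _; rewrite ?mulg1 // mulVKg.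
Qed.

Lemma lampmoveK (H : groupType) (g : H) :
  involutive (fun a : shuffler H => a * lampmove g)%g.
Proof.
case=> s h; rewrite !mul_lampmove /= -mulgA.
by rewrite [X in (_ * X)%g]transpK mulg1.
Qed.

Section Fibres.
Variables (H : groupType) (F : {fset shuffler H}) (P : {fset H}).

Definition fibre_card (s : finSym H) : nat := (\sum_(a <- F) (shuffler_perm a == s))%N.

Definition over (W : {fset finSym H}) : pred (shuffler H) :=
  fun a => shuffler_perm a \in W.

Definition over_card (W : {fset finSym H}) : nat := (\sum_(a <- F) over W a)%N.

Definition over_boundary (W : {fset finSym H}) : nat :=
  (\sum_(g <- P) \sum_(a <- F)
     (over W a && ~~ ((a * lampmove g)%g \in F) || over W a && ~~ over W (a * lampmove g)%g))%N.

(** As lamp moves are involutions, the edges counted here from [s] into [W] are also, reversed,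
    those from [W] into [s]. *)
Definition indegree (W : {fset finSym H}) (s : finSym H) : nat :=
  (\sum_(g <- P) \sum_(a <- F)
     [&& shuffler_perm a == s, (a * lampmove g)%g \in F & over W (a * lampmove g)%g])%N.

Lemma over_cardD1 (W : {fset finSym H}) (s : finSym H) : s \in W ->
  over_card W = (over_card (W `\ s)%fset + fibre_card s)%N.
Proof.
move=> sW; rewrite /over_card /fibre_card -big_split /=; apply: eq_bigr => a _.
by rewrite /over !inE; case: eqP => [->|_]; rewrite ?sW //= addn0.
Qed.

(** Removing [s] discards the boundary edges that start over [s], at least
    [#|P| * fibre_card s - indegree W s] of them, and creates at most [indegree W s] new ones,
    namely the edges from the rest of [W] into [s]. *)
Lemma over_boundaryD1 (W : {fset finSym H}) (s : finSym H) : s \in W ->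
  (over_boundary (W `\ s)%fset + #|` P| * fibre_card s <=
   over_boundary W + (indegree W s).*2)%N.
Proof.
move=> sW; rewrite -addnn.
rewrite card_fset_sum1 big_distrl /= /over_boundary /indegree -!big_split /=.
apply: leq_sum_fset => g _; rewrite mul1n /fibre_card.
set c := (fun a : shuffler H => a * lampmove g)%g.
apply: (@leq_trans (
  \sum_(a <- F) (over W a && ~~ (c a \in F) || over W a && ~~ over W (c a))
  + \sum_(a <- F) [&& shuffler_perm a == s, c a \in F & over W (c a)]
  + \sum_(a <- F) [&& over W a, c a \in F & shuffler_perm (c a) == s])%N); last first.
  by rewrite -addnA !leq_add2l
    (sum_involution_le _ (over W) (fun b => shuffler_perm b == s) (lampmoveK g)).
rewrite -!big_split /=; apply: leq_sum_fset => a aF.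
rewrite /over !inE -/(c a).
case: (eqVneq (shuffler_perm a) s) => [->|nas]; rewrite ?sW /=.
  by case: (c a \in F); case: (shuffler_perm (c a) \in W) => //=; rewrite ?addn0 ?leq_addr.
case: (shuffler_perm a \in W) => //=.
case: (c a \in F) => //=; case: (shuffler_perm (c a) \in W) => //=;
  by case: eqP.
Qed.

(* A fibrewise minimal W with small boundary: removing any of its elements
   makes the boundary large, which forces the degrees inside W to be large. *)
Lemma exists_large_indegree (W0 : {fset finSym H}) :
  (4 * over_boundary W0 < #|` P| * over_card W0)%N ->
  exists W : {fset finSym H}, [/\ (W `<=` W0)%fset, W != fset0 &
    forall s, s \in W -> (3 * #|` P| * fibre_card s < 8 * indegree W s)%N].
Proof.
have [n] := ubnP #|` W0|; elim: n W0 => // n IH W0 W0n bW0.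
case: (pselect (exists2 s, s \in W0 &
    (4 * over_boundary (W0 `\ s)%fset < #|` P| * over_card (W0 `\ s)%fset)%N)).
  move=> [s sW0 bs]; have [|W [WW Wn0 HW]] := IH _ _ bs.
    by move: W0n; rewrite (cardfsD1 s) sW0.
  by exists W; split=> //; apply: fsubset_trans WW (fsubD1set _ _).
move=> nex; exists W0; split=> [||s sW0]; first exact: fsubset_refl.
  apply: contraTneq bW0 => ->; rewrite /over_card big1 ?muln0 //.
have : (#|` P| * over_card (W0 `\ s)%fset <= 4 * over_boundary (W0 `\ s)%fset)%N.
  by rewrite leqNgt; apply/negP => ?; apply: nex; exists s.
(* With [b] for boundary, [v] for volume and [f] for the fibre of [s]: [#|P| (v - f) + 4 #|P| f <= 4
   b + 8 indegree < #|P| v + 8 indegree], whence the factors 3 and 8. *)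
move: bW0 (over_boundaryD1 sW0); rewrite (over_cardD1 sW0).
by rewrite -addnn; nia.
Qed.

Lemma sum_cursor_le (s : finSym H) (g : H) (D : {fset H}) :
  (\sum_(a <- F) ((shuffler_perm a == s) && ((shuffler_cursor a * g)%g \in D)) <= #|` D|)%N.
Proof.
apply: (sum_inj_le (f := fun a => (shuffler_cursor a * g)%g)).
  move=> [s1 h1] [s2 h2]; rewrite !inE /= => /and3P[_ /eqP-> _] /and3P[_ /eqP-> _].
  by move=> /mulIg ->.
by move=> a _ /andP[].
Qed.

(** Pigeonhole. More than [3 q * fibre_card s] edges join [s] to [W]; those with an end in [D]
    number at most [2 * #|D| * #|P|], hence at most [2 q * fibre_card s]. Some cursor position
    therefore keeps at least [q] edges avoiding [D]. *)
Lemma free_position (W : {fset finSym H}) (s : finSym H) (D : {fset H}) (q : nat) :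
  #|` P| = (8 * q)%N -> (8 * #|` D| <= fibre_card s)%N ->
  (3 * #|` P| * fibre_card s < 8 * indegree W s)%N ->
  exists h (Q : {fset H}), [/\ h \notin D, (q <= #|` Q|)%N & forall y, y \in Q ->
    y \notin D /\ (s * transp h y)%g \in W].
Proof.
move=> Pq Ds indeg.
pose good a g := [&& shuffler_perm a == s, over W (a * lampmove g)%g,
  shuffler_cursor a \notin D & (shuffler_cursor a * g)%g \notin D].
suff [a aF qa] : exists2 a, a \in F & (q <= \sum_(g <- P) good a g)%N.
  (* If [q = 0] then [P] is empty, so the degree vanishes, against the strict bound. If [q > 0], one
     good edge shows that [a] lies over [s]. *)
  case: (posnP q) => [q0|q_gt0].
    rewrite q0 in qa Pq *.
    by move: indeg; rewrite /indegree (cardfs0_eq Pq) big_seq_fset0 muln0.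
  have [g0 gP /and4P[/eqP sa _ hD _]] : exists2 g, g \in P & good a g.
    apply: contrapT => nex; move: (leq_trans q_gt0 qa).
    rewrite big_seq big1 // => g gP; apply/eqP; rewrite eqb0.
    by apply/negP => ga; apply: nex; exists g.
  pose Q := [fset (shuffler_cursor a * g)%g | g in [fset g in P | good a g]]%fset.
  exists (shuffler_cursor a), Q; split=> //.
    suff -> : #|` Q| = #|` [fset g in P | good a g]%fset| by rewrite card_fset_filter.
    by apply: card_imfset => ? ? /mulgI.
  move=> y /imfsetP[g /=]; rewrite !inE /= => /andP[_ /and4P[_ W1 _ gD] ->].
  by split=> //; move: W1; rewrite /over mul_lampmove /= sa.
apply: contrapT => nex.
have {nex} le_q a : a \in F -> (\sum_(g <- P) good a g <= (shuffler_perm a == s) * q)%N.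
  move=> aF; case: eqP => [sa|/eqP sa].
    by rewrite mul1n leqNgt; apply/negP => /ltnW qa; apply: nex; exists a.
  by rewrite big1 // => g _; rewrite /good (negbTE sa).
have : (indegree W s <= \sum_(g <- P) (\sum_(a <- F) good a g + #|` D| + #|` D|))%N.
  rewrite /indegree; apply: leq_sum_fset => g _.
  (* The cursor is written as a product with [1] so that [sum_cursor_le] bounds both ends of the
     edge. *)
  apply: (@leq_trans (\sum_(a <- F) (good a g +
     ((shuffler_perm a == s) && ((shuffler_cursor a * g)%g \in D)) +
     ((shuffler_perm a == s) && ((shuffler_cursor a * 1)%g \in D))))).
    apply: leq_sum_fset => a _; rewrite /good mulg1.
    case: (shuffler_perm a == s) => //=; case: (_ \in F) => //=.
    case: (over W _) => //=.
    by case: (shuffler_cursor a \in D) => //=; case: (_ \in D).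
  by rewrite !big_split /= leq_add ?leq_add ?sum_cursor_le.
rewrite !big_split /= exchange_big /= !big_const_seq !count_predT !iter_addn_0.
have : (\sum_(a <- F) \sum_(g <- P) good a g <= fibre_card s * q)%N.
  by rewrite /fibre_card big_distrl /=; apply: leq_sum_fset.
move: indeg (leq_mul (leqnn q) Ds); rewrite Pq.
move: (\sum_(a <- F) _)%N (fibre_card s) (indegree W s) (#|` D|) => x y z d.
by clear; nia.
Qed.

(** [W0] keeps the permutations with at least [k] cursor positions. It carries at least 15/16 of
    [F], and for each [g] at most 2/16 of [F] leaves it: 1/16 exits [F] and 1/16 reaches a small
    fibre. This is enough to extract a minimal [W]. *)
Lemma leq_exp_of_small_boundary (q k : nat) :
  F != fset0 -> #|` P| = (8 * q)%N -> (0 < q)%N ->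
  (16 * \sum_(a <- F) (fibre_card (shuffler_perm a) < k) <= #|` F|)%N ->
  (forall g, g \in P -> 16 * \sum_(a <- F) ((a * lampmove g)%g \notin F) <= #|` F|)%N ->
  (q ^ (k %/ 8) <= #|` F|)%N.
Proof.
move=> F0 Pq q0 small bd.
pose W0 := [fset shuffler_perm a |
    a in [fset a in F | (k <= fibre_card (shuffler_perm a))%N]]%fset.
have overW0 a : a \in F -> over W0 a = (k <= fibre_card (shuffler_perm a))%N.
  move=> aF; apply/imfsetP/idP => /= [[b]|ka].
    by rewrite !inE => /andP[_ kb] ->.
  by exists a => //; rewrite !inE aF.
have cardW0 (W : {fset finSym H}) : (W `<=` W0)%fset -> (#|` W| <= #|` F|)%N.
  move=> /fsubset_leq_card/leq_trans; apply.
  have : (#|` W0| <= #|` [fset a in F | (k <= fibre_card (shuffler_perm a))%N]%fset|)%N.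
    exact: leq_imfset_card.
  move=> /leq_trans; apply.
  by apply: fsubset_leq_card; apply/fsubsetP => a; rewrite !inE => /andP[].
have VW0 : (over_card W0 + \sum_(a <- F) (fibre_card (shuffler_perm a) < k) = #|` F|)%N.
  rewrite card_fset_sum1 /over_card -big_split /= !big_seq; apply: eq_bigr => a aF.
  by rewrite overW0 // ltnNge; case: leqP.
have BW0 : (16 * over_boundary W0 <= 2 * #|` P| * #|` F|)%N.
  rewrite /over_boundary big_distrr /=.
  apply: (@leq_trans (\sum_(g <- P) 2 * #|` F|)%N); last first.
    by rewrite big_const_seq count_predT iter_addn_0 mulnAC.
  apply: leq_sum_fset => g gP.
  have inv : (\sum_(a <- F) [&& true, (a * lampmove g)%g \in F & ~~ over W0 (a * lampmove g)%g]
      <= \sum_(a <- F) (fibre_card (shuffler_perm a) < k))%N.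
    apply: leq_trans (sum_involution_le F predT (fun a => ~~ over W0 a) (lampmoveK g)) _.
    apply: leq_sum_fset => a aF; rewrite overW0 // -ltnNge.
    by case: (_ < _)%N => //=; case: (_ \in F).
  have : (\sum_(a <- F) (over W0 a && ((a * lampmove g)%g \notin F) ||
             over W0 a && ~~ over W0 (a * lampmove g)%g) <=
      \sum_(a <- F) ((a * lampmove g)%g \notin F) +
      \sum_(a <- F) [&& true, (a * lampmove g)%g \in F & ~~ over W0 (a * lampmove g)%g])%N.
    rewrite -big_split /=; apply: leq_sum_fset => a _.
    by case: (over W0 a) => //=; case: (_ \in F) => //=; case: (over W0 _).
  move: inv small (bd g gP).
  by move: (\sum_(a <- F) _)%N (\sum_(a <- F) _)%N (\sum_(a <- F) _)%N (\sum_(a <- F) _)%N; lia.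
have Fgt : (0 < #|` F|)%N by rewrite cardfs_gt0.
have [|W [WW0 Wn0 HW]] := @exists_large_indegree W0.
  by move: BW0 VW0 small; move: (\sum_(a <- F) _)%N; nia.
apply: leq_trans (cardW0 _ WW0).
(* Fewer than [k %/ 8] revealed positions give [8 * #|D| <= k], at most the fibre of any [s] in [W],
   as [W] is contained in [W0]. *)
apply: leq_exp_of_branching => // s D sW Dk; apply: free_position (HW _ sW) => //.
have : over W0 (Shuffler s 1%g) by apply: (fsubsetP WW0).
move=> /imfsetP[a /=]; rewrite !inE => /andP[_ ka] /= ->.
by apply: leq_trans ka; rewrite (leq_trans _ (leq_trunc_div k 8)) // mulnC leq_pmul2r // ltnW.
Qed.

End Fibres.

(** * Sums, gradients and profiles *)

Definition lsum (R : realType) (T : choiceType) (u : T -> R) : \bar R :=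
  (\esum_(x in [set: T]) (u x)%:E)%E.

Lemma lsum_ge0 (R : realType) (T : choiceType) (u : T -> R) :
  (forall x, 0 <= u x) -> (0 <= lsum u)%E.
Proof. by move=> u0; apply: esum_ge0 => x _; rewrite lee_fin. Qed.

Lemma le_lsum (R : realType) (T : choiceType) (u v : T -> R) :
  (forall x, u x <= v x) -> (lsum u <= lsum v)%E.
Proof. by move=> uv; apply: le_esum => x _; rewrite lee_fin. Qed.

Lemma eq_lsum (R : realType) (T : choiceType) (u v : T -> R) :
  (forall x, u x = v x) -> lsum u = lsum v.
Proof. by move=> uv; apply: eq_esum => x _; rewrite uv. Qed.

Lemma lsum0 (R : realType) (T : choiceType) : lsum (fun _ : T => 0 : R) = 0%E.
Proof. exact: esum1. Qed.

Lemma lsumD (R : realType) (T : choiceType) (u v : T -> R) :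
  (forall x, 0 <= u x) -> (forall x, 0 <= v x) ->
  lsum (fun x => u x + v x) = (lsum u + lsum v)%E.
Proof.
by move=> u0 v0; rewrite /lsum -esumD // => x _; rewrite lee_fin.
Qed.

(** One inequality holds for every non-negative factor; for [c > 0] the other one is the same
    inequality for [c^-1]. *)
Lemma lsumZ (R : realType) (T : choiceType) (c : R) (u : T -> R) :
  0 <= c -> (forall x, 0 <= u x) -> lsum (fun x => c * u x) = (c%:E * lsum u)%E.
Proof.
have le (d : R) (v : T -> R) : 0 <= d -> (forall x, 0 <= v x) ->
    (lsum (fun x => d * v x)%R <= d%:E * lsum v)%E.
  move=> d0 v0; apply: ge_ereal_sup => _ [X [finX _] <-].
  under eq_fsbigr do rewrite EFinM.
  rewrite -ge0_mule_fsumr; last by move=> x; rewrite lee_fin.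
  by apply: lee_wpmul2l; [rewrite lee_fin|apply: ereal_sup_ubound; exists X].
rewrite le_eqVlt => /predU1P[<-|c0] u0.
  by rewrite mul0e -(lsum0 R T); apply: eq_lsum => x; rewrite mul0r.
apply/eqP; rewrite eq_le (le _ _ (ltW c0) u0) /=.
rewrite muleC -lee_pdivlMr // muleC.
apply: le_trans (le c^-1 (fun x => c * u x) _ _); last 2 first.
- by rewrite invr_ge0 ltW.
- by move=> x; rewrite mulr_ge0 // ltW.
by apply: le_lsum => x; rewrite mulKf // gt_eqF.
Qed.

Lemma lsum_sum (R : realType) (T : choiceType) (I : eqType) (s : seq I) (u : I -> T -> R) :
  (forall i x, 0 <= u i x) ->
  lsum (fun x => \sum_(i <- s) u i x) = (\sum_(i <- s) lsum (u i))%E.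
Proof.
move=> u0; elim: s => [|i s IH].
  by rewrite big_nil -(lsum0 R T); apply: eq_lsum => x; rewrite big_nil.
rewrite big_cons -IH -lsumD //; last by move=> x; apply: sumr_ge0.
by apply: eq_lsum => x; rewrite big_cons.
Qed.

Lemma lsum_fset (R : realType) (T : choiceType) (A : {fset T}) (u : T -> R) :
  (forall x, 0 <= u x) -> (forall x, x \notin A -> u x = 0) ->
  lsum u = (\sum_(x <- A) u x)%:E.
Proof.
move=> u0 uA; rewrite /lsum (esumID [set` A]); last by move=> x _; rewrite lee_fin.
rewrite setTI [X in (_ + X)%E]esum1 ?adde0; last first.
  by move=> x [_ /= /negP/uA ->].
rewrite esum_fset; [|exact: finite_fset|by move=> x _; rewrite lee_fin].
by rewrite fsbig_finite ?set_fsetK //= sumEFin.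
Qed.

Lemma lsum_reindex (R : realType) (T U : choiceType) (e : T -> U) (u : U -> R) :
  bijective e -> lsum u = lsum (fun x => u (e x)).
Proof. by move=> be; apply: (reindex_esum setT setT e); rewrite setTT_bijective. Qed.

Lemma lsum_pair (R : realType) (T U V : choiceType) (e : T -> U -> V) (u : V -> R) :
  bijective (fun z => e z.1 z.2) -> (forall x, 0 <= u x) ->
  lsum u = (\esum_(x in [set: T]) lsum (fun y => u (e x y)))%E.
Proof.
move=> be u0; rewrite (lsum_reindex _ be) /lsum.
rewrite (esum_esum (J := fun=> setT) (a := fun x y => (u (e x y))%:E)).
  by congr esum; apply/seteqP; split.
by move=> *; rewrite lee_fin.
Qed.

Lemma powR_norm_add_le (R : realType) (p a b : R) : 0 <= p ->
  `|a + b| `^ p <= 2 `^ p * (`|a| `^ p + `|b| `^ p).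
Proof.
move=> p0; wlog ab : a b / `|a| <= `|b|.
  move=> wl; have [/wl//|/ltW/wl] := leP `|a| `|b|.
  by rewrite [b + a]addrC [X in _ * X]addrC.
apply: (@le_trans _ _ ((2 * `|b|) `^ p)).
  apply: ge0_ler_powR => //; rewrite ?nnegrE ?mulr_ge0 //.
  by apply: (le_trans (ler_normD _ _)); rewrite mulrDl mul1r lerD2r.
by rewrite powRM // ler_wpM2l ?powR_ge0 // lerDr powR_ge0.
Qed.

(** * Energies along group elements *)

Definition energy (R : realType) (p : R) (G : groupType) (f : G -> R) (g : G) : \bar R :=
  lsum (fun x => `|f x - f (x * g)%g| `^ p).

(** The [p]-th power of [gradnorm], split by generator so that each direction can be estimated
    separately. *)
Definition dirichlet (R : realType) (p : R) (G : groupType) (S : {fset G}) (f : G -> R) : \bar R :=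
  (\sum_(s <- S) energy p f s)%E.

Lemma energy_ge0 (R : realType) (p : R) (G : groupType) (f : G -> R) (g : G) :
  (0 <= energy p f g)%E.
Proof. by apply: lsum_ge0 => x; apply: powR_ge0. Qed.

Lemma dirichlet_ge0 (R : realType) (p : R) (G : groupType) (S : {fset G}) (f : G -> R) :
  (0 <= dirichlet p S f)%E.
Proof. by apply: sume_ge0 => s _; apply: energy_ge0. Qed.

Lemma dirichletE (R : realType) (p : R) (G : groupType) (S : {fset G}) (f : G -> R) :
  dirichlet p S f = lsum (fun x => \sum_(s <- S) `|f x - f (x * s)%g| `^ p).
Proof. by rewrite lsum_sum // => *; apply: powR_ge0. Qed.

Lemma gradnormE (R : realType) (p : R) (G : groupType) (S : {fset G}) (f : G -> R) :
  gradnorm p S f = (dirichlet p S f `^ p^-1)%E.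
Proof.
rewrite /gradnorm /lpnorm dirichletE; congr (_ `^ _)%E.
have -> : ([set: G] `*` [set` S] = [set: G] `*`` (fun _ => [set` S]))%classic.
  by apply/seteqP; split.
rewrite -(@esum_esum _ _ _ setT (fun _ => [set` S]%classic)
   (fun x s => (`|f x - f (x * s)%g| `^ p)%:E)); last first.
  by move=> *; rewrite lee_fin powR_ge0.
apply: eq_esum => x _.
rewrite esum_fset; [|exact: finite_fset|by move=> *; rewrite lee_fin powR_ge0].
by rewrite fsbig_finite ?set_fsetK //= sumEFin.
Qed.

Lemma energy1 (R : realType) (p : R) (G : groupType) (f : G -> R) : 0 < p ->
  energy p f 1%g = 0%E.
Proof.
move=> p0; rewrite /energy -(lsum0 R G); apply: eq_lsum => x.
by rewrite mulg1 subrr normr0 powR0 // gt_eqF.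
Qed.

Lemma mulg_bij (G : groupType) (g : G) : bijective (fun x => x * g)%g.
Proof. by exists (fun x => x * g^-1)%g => x; rewrite ?mulgK ?mulgVK. Qed.

Lemma energyV (R : realType) (p : R) (G : groupType) (f : G -> R) (g : G) :
  energy p f g^-1%g = energy p f g.
Proof.
rewrite /energy (lsum_reindex _ (mulg_bij g)); apply: eq_lsum => x.
by rewrite mulgK distrC.
Qed.

Lemma energyM (R : realType) (p : R) (G : groupType) (f : G -> R) (g h : G) : 0 <= p ->
  (energy p f (g * h)%g <= (2 `^ p)%:E * (energy p f g + energy p f h))%E.
Proof.
move=> p0; rewrite {3}/energy (lsum_reindex _ (mulg_bij g)).
rewrite -lsumD; try by move=> x; apply: powR_ge0.
rewrite -lsumZ ?powR_ge0 //.
apply: le_lsum => x; apply: le_trans (powR_norm_add_le _ _ p0).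
by rewrite mulgA addrA subrK.
Qed.

(** The elements [g] admitting such a constant, uniform in [f], form a subgroup containing [S]. This
    makes the estimates independent of the generating set. *)
Lemma energy_le_dirichlet (R : realType) (p : R) (G : groupType) (S : {fset G}) (g : G) :
  0 < p -> generates S ->
  exists2 C : R, 0 < C & forall f : G -> R, (energy p f g <= C%:E * dirichlet p S f)%E.
Proof.
move=> p0 genS.
pose A := [set g | exists2 C : R, 0 < C &
  forall f : G -> R, (energy p f g <= C%:E * dirichlet p S f)%E]%classic.
suff : A g by [].
suff -> : A = setT by [].
apply: genS => [s /= sS||g1 g2 [C1 C10 H1] [C2 C20 H2]|g1 [C1 C10 H1]].
- exists 1 => // f; rewrite mul1e /dirichlet (big_fsetD1 s) //= leeDl //.
  by apply: sume_ge0 => ? _; apply: energy_ge0.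
- by exists 1 => // f; rewrite energy1 // mul1e dirichlet_ge0.
- exists (2 `^ p * (C1 + C2)); first by rewrite mulr_gt0 ?powR_gt0 ?addr_gt0.
  move=> f; apply: le_trans (energyM _ _ _ (ltW p0)) _.
  rewrite EFinM -muleA; apply: lee_wpmul2l; first by rewrite lee_fin powR_ge0.
  rewrite EFinD ge0_muleDl ?lee_fin ?(ltW C10) ?(ltW C20) //.
  exact: leeD.
- by exists C1 => // f; rewrite energyV.
Qed.

Lemma sum_energy_le_dirichlet (R : realType) (p : R) (G : groupType) (S : {fset G})
    (I : eqType) (s : seq I) (e : I -> G) :
  0 < p -> generates S ->
  exists2 C : R, 0 < C & forall f : G -> R,
    (\sum_(i <- s) energy p f (e i) <= C%:E * dirichlet p S f)%E.
Proof.
move=> p0 genS; elim: s => [|i s [C C0 HC]].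
  by exists 1 => // f; rewrite big_nil mul1e dirichlet_ge0.
have [D D0 HD] := energy_le_dirichlet (e i) p0 genS.
exists (D + C); first exact: addr_gt0.
move=> f; rewrite big_cons EFinD ge0_muleDl ?lee_fin ?(ltW C0) ?(ltW D0) //.
exact: leeD.
Qed.

(** * From sets to functions in [l^1] *)

Definition findic (R : realType) (T : choiceType) (A : {fset T}) (x : T) : R := (x \in A)%:R.

Lemma findic_ge0 (R : realType) (T : choiceType) (A : {fset T}) (x : T) : 0 <= findic R A x.
Proof. by rewrite ler0n. Qed.

Lemma lsum_findic (R : realType) (T : choiceType) (A : {fset T}) :
  lsum (findic R A) = (#|` A|%:R)%:E.
Proof.
rewrite (@lsum_fset _ _ A); [|exact: findic_ge0|by move=> x /negbTE xA; rewrite /findic xA].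
congr (_%:E); rewrite card_fset_sum1 natr_sum !big_seq.
by apply: eq_bigr => x xA; rewrite /findic xA.
Qed.

(** On every edge the increments of the layer [m * findic R A] and of the remainder never have
    opposite signs, so absolute values add up exactly. *)
Lemma energy_layer (R : realType) (G : groupType) (A : {fset G}) (m : R) (u : G -> R) (g : G) :
  0 <= m -> (forall x, x \in A -> m <= u x) -> (forall x, x \notin A -> u x = 0) ->
  energy 1 u g = (m%:E * energy 1 (findic R A) g +
                  energy 1 (fun x => u x - m * findic R A x)%R g)%E.
Proof.
move=> m0 uA u0; rewrite /energy -lsumZ; [|by []|by move=> x; apply: powR_ge0].
rewrite -lsumD; last by move=> x; apply: powR_ge0.
  apply: eq_lsum => x; rewrite !powRr1 // /findic.
  case: (boolP (x \in A)) => [/uA xA|/u0 ->];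
  case: (boolP ((x * g)%g \in A)) => [/uA gA|/u0 ->].
  - by rewrite subrr normr0 mulr0 add0r; congr (`|_|); ring.
  - rewrite !(subr0, mulr0, mulr1, normr1) !ger0_norm ?subr_ge0 ?(le_trans m0) //.
    by ring.
  - rewrite !(mulr0, subr0, sub0r, oppr0, normrN, mulr1, normr1).
    rewrite !ger0_norm ?subr_ge0 ?(le_trans m0) //.
    by ring.
  - by rewrite !(subr0, mulr0, normr0, addr0).
by move=> x; rewrite mulr_ge0 // powR_ge0.
Qed.

Lemma dirichlet_layer (R : realType) (G : groupType) (S A : {fset G}) (m : R) (u : G -> R) :
  0 <= m -> (forall x, x \in A -> m <= u x) -> (forall x, x \notin A -> u x = 0) ->
  dirichlet 1 S u = (m%:E * dirichlet 1 S (findic R A) +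
                     dirichlet 1 S (fun x => u x - m * findic R A x)%R)%E.
Proof.
move=> m0 uA u0; rewrite /dirichlet ge0_sume_distrr; last by move=> *; apply: energy_ge0.
by rewrite -big_split /=; apply: eq_bigr => s _; apply: energy_layer.
Qed.

Lemma fset_argmin (R : realType) (T : choiceType) (A : {fset T}) (u : T -> R) :
  A != fset0 -> exists2 x, x \in A & forall y, y \in A -> u x <= u y.
Proof.
move=> /fset0Pn[a aA].
have [i _ Hi] := @Order.TotalTheory.arg_minP _ R A [` aA]%fset xpredT (fun i => u (val i)) isT.
by exists (val i) => [|y yA]; [exact: valP|exact: (Hi [` yA]%fset)].
Qed.

(* Discrete coarea: peel off the layer of height [min u] over the support. *)
Lemma l1_isoperimetry (R : realType) (G : groupType) (S : {fset G}) (T : R) (n : nat) :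
  0 <= T ->
  (forall F : {fset G}, F != fset0 -> (#|` F| <= n)%N ->
    ((#|` F|%:R)%:E <= T%:E * dirichlet 1 S (findic R F))%E) ->
  forall (A : {fset G}) (u : G -> R), (#|` A| <= n)%N ->
    (forall x, 0 <= u x) -> (forall x, x \notin A -> u x = 0) ->
    (lsum u <= T%:E * dirichlet 1 S u)%E.
Proof.
move=> T0 isoF A; have [k] := ubnP #|` A|; elim: k A => // k IH A Ak u An u0 uA.
have [A0|An0] := eqVneq A fset0.
  rewrite (_ : lsum u = 0%E) ?mule_ge0 ?dirichlet_ge0 //.
  by rewrite -(lsum0 R G); apply: eq_lsum => x; rewrite uA // A0 in_fset0.
have [a aA min_a] := fset_argmin u An0.
rewrite (dirichlet_layer _ (u0 a) min_a uA) ge0_muleDr ?mule_ge0 ?lee_fin ?dirichlet_ge0 //.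
pose v := fun x => u x - u a * findic R A x.
have v0 x : 0 <= v x.
  rewrite /v /findic; case: (boolP (x \in A)) => xA; last by rewrite mulr0 subr0.
  by rewrite mulr1 subr_ge0 min_a.
rewrite (_ : lsum u = lsum (fun x => u a * findic R A x + v x)); last first.
  by apply: eq_lsum => x; rewrite /v addrC subrK.
rewrite lsumD //; last by move=> x; rewrite mulr_ge0 // findic_ge0.
rewrite lsumZ //.
apply: leeD.
  by rewrite muleCA lsum_findic; apply: lee_wpmul2l; rewrite ?lee_fin ?isoF.
(* The remainder [v] vanishes at the minimiser [a], so its support has lost a point and the
   induction applies. *)
have cardA : #|` A| = #|` (A `\ a)%fset|.+1 by rewrite (cardfsD1 a A) aA.
apply: (IH (A `\ a)%fset) => //; [by rewrite -ltnS -cardA|by rewrite ltnW // -cardA|].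
move=> x; rewrite !inE negb_and negbK /v /findic => /orP[/eqP->|xA].
  by rewrite aA mulr1 subrr.
by rewrite uA // (negbTE xA) mulr0 subr0.
Qed.

(** * From [l^1] to [l^p] inequalities *)

Lemma bernoulli_le (R : realType) (t : R) (n : nat) : 0 <= t <= 1 ->
  1 - t ^+ n <= n%:R * (1 - t).
Proof.
move=> /andP[t0 t1]; elim: n => [|n IH]; first by rewrite expr0 mul0r subrr.
rewrite exprS -natr1; have : t ^+ n <= 1 by apply: exprn_ile1.
nra.
Qed.

(** With [b <= a], [t = b / a] and an integer [n >= p], one has [1 - t^p <= 1 - t^n <= n (1 - t)].
    Both terms on the right keep the bound symmetric in [a] and [b]. *)
Lemma powR_sub_le (R : realType) (p : R) : 1 <= p ->
  exists2 n : R, 0 < n & forall a b : R, 0 <= a -> 0 <= b ->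
    `|a `^ p - b `^ p| <= n * (`|a - b| * a `^ (p - 1) + `|a - b| * b `^ (p - 1)).
Proof.
move=> p1; have p0 : 0 < p by apply: lt_le_trans p1.
exists (Num.bound p)%:R.
  by rewrite (lt_le_trans p0) // ltW // (le_lt_trans _ (archi_boundP (ltW p0))).
have pn : p <= (Num.bound p)%:R by rewrite ltW // archi_boundP // ltW.
move: (Num.bound p) pn => n pn a b; wlog ba : a b / b <= a.
  move=> wl a0 b0; have [/wl->//|/ltW/wl wl1] := leP b a.
  by rewrite (distrC (a `^ p)) (distrC a) [X in _ * X]addrC; apply: wl1.
move=> a0 b0; have [a_eq0|an0] := eqVneq a 0.
  have -> : b = a by apply/eqP; rewrite eq_le ba a_eq0 b0.
  by rewrite !subrr normr0 !mul0r addr0 mulr0.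
have agt0 : 0 < a by rewrite lt_def an0.
rewrite ger0_norm; last by rewrite subr_ge0 ge0_ler_powR // ltW.
rewrite ger0_norm ?subr_ge0 //.
apply: (@le_trans _ _ (n%:R * ((a - b) * a `^ (p - 1)))); last first.
  by rewrite ler_wpM2l // lerDl mulr_ge0 ?powR_ge0 ?subr_ge0.
pose t := b / a; have bE : b = t * a by rewrite mulfVK.
have t0 : 0 <= t by rewrite divr_ge0.
have t1 : t <= 1 by rewrite ler_pdivrMr // mul1r.
have := bernoulli_le n (introT andP (conj t0 t1)).
have : t ^+ n <= t `^ p.
  have [t_eq0|tn0] := eqVneq t 0.
    rewrite t_eq0 powR0 ?gt_eqF // expr0n; case: n pn {bE t0 t1} => //.
    by rewrite leNgt p0.
  by rewrite -powR_mulrn //; apply: ger_powR; rewrite // lt_def tn0 t0.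
rewrite bE powRM // -(mulr_powRB1 a0 p0) => tp bern.
have -> : a * a `^ (p - 1) - t `^ p * (a * a `^ (p - 1)) =
  (1 - t `^ p) * (a * a `^ (p - 1)) by ring.
have -> : n%:R * ((a - t * a) * a `^ (p - 1)) =
  (n%:R * (1 - t)) * (a * a `^ (p - 1)) by ring.
rewrite ler_wpM2r ?mulr_ge0 ?powR_ge0 //; lra.
Qed.

(** A weighted Young inequality, by comparing [c * a] with [b]: one of the two terms on the right
    suffices in each case. *)
Lemma mulr_powRB1_le (R : realType) (p c a b : R) : 1 <= p -> 0 < c -> 0 <= a -> 0 <= b ->
  a * b `^ (p - 1) <= c^-1 * b `^ p + c `^ (p - 1) * a `^ p.
Proof.
move=> p1 c0 a0 b0; have p0 : 0 < p by apply: lt_le_trans p1.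
have [ab|ba] := leP (c * a) b.
  rewrite (@le_trans _ _ (c^-1 * b `^ p)) // ?lerDl ?mulr_ge0 ?powR_ge0 //.
  rewrite -(mulr_powRB1 b0 p0) mulrA ler_wpM2r ?powR_ge0 //.
  by rewrite mulrC ler_pdivlMr // mulrC.
rewrite (@le_trans _ _ (c `^ (p - 1) * a `^ p)) // ?lerDr
  ?mulr_ge0 ?powR_ge0 ?invr_ge0 ?(ltW c0) //.
rewrite -(mulr_powRB1 a0 p0) mulrCA ler_wpM2l //.
rewrite -powRM ?(ltW c0) // ge0_ler_powR ?nnegrE ?subr_ge0 ?mulr_ge0 ?(ltW c0) //.
exact: ltW.
Qed.

Lemma energy_powR_le (R : realType) (p n c : R) (G : groupType) (f : G -> R) (g : G) :
  1 <= p -> 0 < n -> 0 < c -> (forall x, 0 <= f x) ->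
  (forall a b : R, 0 <= a -> 0 <= b ->
    `|a `^ p - b `^ p| <= n * (`|a - b| * a `^ (p - 1) + `|a - b| * b `^ (p - 1))) ->
  (energy 1 (fun x => f x `^ p)%R g <=
   (n * c^-1 * 2)%:E * lsum (fun x => f x `^ p)%R +
   (n * c `^ (p - 1) * 2)%:E * energy p f g)%E.
Proof.
move=> p1 n0 c0 f0 Hn.
have fp0 x : 0 <= f x `^ p by apply: powR_ge0.
have -> : ((n * c^-1 * 2)%:E * lsum (fun x => f x `^ p)%R =
  (n * c^-1)%:E * (lsum (fun x => f x `^ p)%R + lsum (fun x => f (x * g)%g `^ p)%R))%E.
  rewrite -(lsum_reindex (fun x => f x `^ p) (mulg_bij g)).
  by rewrite EFinM -muleA; congr (_ * _)%E; rewrite -mule2n muleC -mule_natl muleC.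
rewrite -lsumD // -lsumZ ?mulr_ge0 ?invr_ge0 ?(ltW n0) ?(ltW c0) //; last first.
  by move=> x; rewrite addr_ge0.
rewrite {2}/energy -lsumZ ?mulr_ge0 ?powR_ge0 ?(ltW n0) //.
rewrite -lsumD; last 2 first.
- by move=> x; rewrite !mulr_ge0 ?invr_ge0 ?addr_ge0 ?(ltW n0) ?(ltW c0).
- by move=> x; rewrite !mulr_ge0 ?powR_ge0 ?(ltW n0).
apply: le_lsum => x; rewrite powRr1 //; apply: le_trans (Hn _ _ (f0 _) (f0 _)) _.
have := mulr_powRB1_le p1 c0 (normr_ge0 (f x - f (x * g)%g)) (f0 x).
have := mulr_powRB1_le p1 c0 (normr_ge0 (f x - f (x * g)%g)) (f0 (x * g)%g).
move=> h1 h2; have := ler_wpM2l (ltW n0) (lerD h1 h2); rewrite [_ * `|_ - _| `^ _]mulrC; lra.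
Qed.

(** The [l^1] inequality is applied to [f^p]. The weight in Young's inequality is tuned to make the
    [l^p] mass on the right at most half of the mass on the left, where it is absorbed. *)
Lemma lp_isoperimetry (R : realType) (p : R) (G : groupType) (S : {fset G}) : 1 <= p ->
  exists2 c : R, 0 < c & forall (T : R) (A : {fset G}), 0 < T ->
    (forall u : G -> R, (forall x, 0 <= u x) -> (forall x, x \notin A -> u x = 0) ->
      (lsum u <= T%:E * dirichlet 1 S u)%E) ->
    forall f : G -> R, (forall x, 0 <= f x) -> (forall x, x \notin A -> f x = 0) ->
      (lsum (fun x => f x `^ p)%R <= ((c * T) `^ p)%:E * dirichlet p S f)%E.
Proof.
move=> p1; have p0 : 0 < p by apply: lt_le_trans p1.
have [n n0 Hn] := powR_sub_le p1.
pose m : R := #|` S|%:R.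
have m0 : 0 <= m by rewrite ler0n.
(* With weight [c = 4 n (m + 1) T] the mass has coefficient [2 n m T / c <= 1/2], and the remaining
   [4 n T c^(p-1)] is at most [c^p]. *)
exists (4 * n * (m + 1)); first by rewrite !mulr_gt0 // ltr_wpDl.
move=> T A T0 iso f f0 fA; set c := 4 * n * (m + 1) * T.
have c0 : 0 < c by rewrite /c !mulr_gt0 // ltr_wpDl.
have fp0 x : 0 <= f x `^ p by apply: powR_ge0.
have fpA x : x \notin A -> f x `^ p = 0 by move=> /fA ->; rewrite powR0 // gt_eqF.
have := iso _ fp0 fpA; have /= NE := lsum_fset fp0 fpA.
set N := \sum_(x <- A) _ in NE.
have : (dirichlet 1 S (fun x => f x `^ p)%R <=
    (m * (n * c^-1 * 2) * N)%:E + (n * c `^ (p - 1) * 2)%:E * dirichlet p S f)%E.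
  have -> : (m * (n * c^-1 * 2) * N)%:E =
      (\sum_(s <- S) (n * c^-1 * 2)%:E * lsum (fun x => f x `^ p)%R)%E.
    rewrite NE -EFinM sumEFin big_const_seq count_predT iter_addr_0.
    by rewrite -mulrA mulr_natl.
  rewrite /dirichlet ge0_sume_distrr; last by move=> *; apply: energy_ge0.
  rewrite -big_split /=; apply: lee_sum => s _.
  exact: energy_powR_le.
have := dirichlet_ge0 p S f; case: (dirichlet p S f) => [D|_ _ _|//]; last first.
  by rewrite gt0_muley ?leey // lte_fin powR_gt0.
rewrite lee_fin => D0 hD hN.
have T0' : (0 <= T%:E)%E by rewrite lee_fin ltW.
have {hD hN} := le_trans hN (lee_wpmul2l T0' hD).
rewrite NE -!EFinM.
rewrite !lee_fin.
have -> : T * (m * (n * c^-1 * 2) * N + n * c `^ (p - 1) * 2 * D) =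
  (2 * n * m * T * c^-1) * N + (2 * n * T) * c `^ (p - 1) * D by ring.
have N0 : 0 <= N by apply: sumr_ge0.
have h1 : 2 * n * m * T * c^-1 <= 2^-1.
  rewrite ler_pdivrMr // /c; nra.
have h2 : 2 * (2 * n * T) * c `^ (p - 1) <= c `^ p.
  rewrite -(mulr_powRB1 (ltW c0) p0) ler_wpM2r ?powR_ge0 // /c.
  have : 0 <= n * m * T by rewrite !mulr_ge0 // ltW.
  lra.
have := ler_wpM2r N0 h1; have := ler_wpM2r D0 h2; lra.
Qed.

(** * Profile bounds as functional inequalities *)

Lemma energy_finsupp (R : realType) (p : R) (G : groupType) (A : {fset G}) (f : G -> R) (g : G) :
  0 < p -> (forall x, x \notin A -> f x = 0) -> energy p f g \is a fin_num.
Proof.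
move=> p0 fA; rewrite ge0_fin_numE ?energy_ge0 //.
have fp0 x : 0 <= `|f x| `^ p by apply: powR_ge0.
have : (energy p f g <= (2 `^ p)%:E *
    (lsum (fun x => `|f x| `^ p)%R + lsum (fun x => `|f (x * g)%g| `^ p)%R))%E.
  rewrite -lsumD // -lsumZ ?powR_ge0 //.
  apply: le_lsum => x; rewrite -(normrN (f (x * g)%g)).
  exact/powR_norm_add_le/ltW.
move=> /le_lt_trans; apply.
rewrite -(lsum_reindex (fun x => `|f x| `^ p) (mulg_bij g)).
rewrite (@lsum_fset _ _ A) //; last by move=> x /fA ->; rewrite normr0 powR0 // gt_eqF.
by rewrite -EFinD -EFinM ltry.
Qed.

Lemma dirichlet_finsupp (R : realType) (p : R) (G : groupType) (S A : {fset G}) (f : G -> R) :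
  0 < p -> (forall x, x \notin A -> f x = 0) ->
  exists2 d : R, 0 <= d & dirichlet p S f = d%:E.
Proof.
move=> p0 fA; have : dirichlet p S f \is a fin_num.
  by rewrite /dirichlet sum_fin_num; apply/allP => e /mapP[s _ ->]; apply: energy_finsupp fA.
move=> fin; exists (fine (dirichlet p S f)); first exact/fine_ge0/dirichlet_ge0.
by rewrite fineK.
Qed.

Lemma lsum_powR_finsupp (R : realType) (p : R) (T : choiceType) (A : {fset T}) (f : T -> R) :
  0 < p -> (forall x, 0 <= f x) -> (exists x, f x != 0) -> (forall x, x \notin A -> f x = 0) ->
  exists2 n : R, 0 < n & lsum (fun x => f x `^ p)%R = n%:E.
Proof.
move=> p0 f0 [a fa] fA; have fp0 x : 0 <= f x `^ p by apply: powR_ge0.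
rewrite (lsum_fset (A := A)) //; last by move=> x /fA ->; rewrite powR0 // gt_eqF.
exists (\sum_(x <- A) f x `^ p) => //.
have aA : a \in A by apply: contraNT fa => /fA ->.
rewrite (big_fsetD1 a) //= ltr_pwDl ?sumr_ge0 //.
by rewrite powR_gt0 // lt_def fa /=.
Qed.

Lemma poweR_ratio (R : realType) (q a b : R) : 0 < q -> 0 < a -> 0 <= b ->
  (a%:E `^ q / b%:E `^ q)%E = if b == 0 then +oo%E else ((a / b) `^ q)%:E.
Proof.
move=> q0 a0 b0; rewrite !poweR_EFin inver powR_eq0 (gt_eqF q0) andbT.
case: eqP => [_|_]; first by rewrite gt0_muley // lte_fin powR_gt0.
rewrite -EFinM powRM ?invr_ge0 ?(ltW a0) //; congr (_ * _)%:E.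
by rewrite -powR_inv1 // powRAC powR_inv1 ?powR_ge0.
Qed.

Lemma le_profile (R : realType) (p x : R) (G : groupType) (S A : {fset G}) (f : G -> R) :
  (forall g, 0 <= f g) -> (exists g, f g != 0) -> (forall g, g \notin A -> f g = 0) ->
  #|` A|%:R <= x ->
  (lsum (fun g => f g `^ p)%R `^ p^-1 / dirichlet p S f `^ p^-1 <= profile p S x)%E.
Proof.
move=> f0 fn0 fA Ax; apply: ereal_sup_ubound; exists f; last first.
  rewrite gradnormE /lpnorm; congr (_ `^ _ / _)%E.
  by apply: eq_lsum => g; rewrite ger0_norm.
have suppA : (supp f `<=` [set` A])%classic.
  by move=> g; rewrite /supp /=; apply: contraNT => /fA ->.
have fin : finite_set (supp f) by apply: sub_finite_set suppA _.
split=> //; apply: le_trans Ax; rewrite ler_nat; apply: fsubset_leq_card.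
by apply/fsubsetP => g; rewrite in_fset_set // inE => /suppA.
Qed.

Lemma profile_le (R : realType) (p x : R) (G : groupType) (S : {fset G}) (K : \bar R) :
  (forall (A : {fset G}) (f : G -> R), (forall g, 0 <= f g) -> (exists g, f g != 0) ->
    (forall g, g \notin A -> f g = 0) -> #|` A|%:R <= x ->
    (lsum (fun g => f g `^ p)%R `^ p^-1 / dirichlet p S f `^ p^-1 <= K)%E) ->
  (profile p S x <= K)%E.
Proof.
move=> H; apply: ge_ereal_sup => _ [f [f0 fn0 fin fx] <-].
rewrite gradnormE /lpnorm.
rewrite (_ : \esum_(g in _) _ = lsum (fun g => f g `^ p)%R).
  apply: H fx => // g; rewrite in_fset_set // => gf; apply/eqP.
  by apply: contraNT gf; rewrite inE.
by apply: eq_lsum => g; rewrite ger0_norm.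
Qed.

Lemma profile_ge0 (R : realType) (p x : R) (G : groupType) (S : {fset G}) :
  1 <= x -> (0 <= profile p S x)%E.
Proof.
move=> x1; pose E := [fset (1 : G)%g]%fset.
apply: le_trans (@le_profile _ p x _ S E (findic R E) _ _ _ _).
- by rewrite mule_ge0 ?inve_ge0 ?poweR_ge0.
- exact: findic_ge0.
- by exists 1%g; rewrite /findic in_fset1 eqxx oner_eq0.
- by move=> g /negbTE gA; rewrite /findic gA.
- by rewrite cardfs1.
Qed.

(** A finite bound [r] excludes the value [+oo] of the ratio, hence a vanishing gradient for [f]
    non-zero; the case [f = 0] is trivial. *)
Lemma lsum_le_of_profile (R : realType) (x r : R) (G : groupType) (S A : {fset G}) (f : G -> R) :
  0 <= r -> (profile 1 S x <= r%:E)%E -> (forall g, 0 <= f g) ->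
  (forall g, g \notin A -> f g = 0) -> #|` A|%:R <= x ->
  (lsum f <= r%:E * dirichlet 1 S f)%E.
Proof.
move=> r0 Hr f0 fA Ax; case: (pselect (exists g, f g != 0)) => [fn0|fn0]; last first.
  rewrite (_ : lsum f = 0%E) ?mule_ge0 ?dirichlet_ge0 //.
  rewrite -(lsum0 R G); apply: eq_lsum => g; apply/eqP.
  by apply: contrapT => fg; apply: fn0; exists g; apply/negP.
have := le_trans (le_profile 1 S f0 fn0 fA Ax) Hr.
have [d d0 ->] := dirichlet_finsupp S ltr01 fA.
rewrite (_ : lsum f = lsum (fun g => f g `^ 1)%R); last by apply: eq_lsum => g; rewrite powRr1.
have [n n0 ->] := lsum_powR_finsupp ltr01 f0 fn0 fA.
rewrite poweR_ratio ?invr_gt0 //; case: eqVneq => [_|dn0]; first by rewrite leye_eq.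
by rewrite invr1 powRr1 ?divr_ge0 ?(ltW n0) // !lee_fin ler_pdivrMr // lt_def dn0.
Qed.

Lemma profile_le_of_lsum (R : realType) (p x K : R) (G : groupType) (S : {fset G}) :
  0 < p -> 0 < K ->
  (forall (A : {fset G}) (f : G -> R), (forall g, 0 <= f g) ->
    (forall g, g \notin A -> f g = 0) -> #|` A|%:R <= x ->
    (lsum (fun g => f g `^ p)%R <= (K `^ p)%:E * dirichlet p S f)%E) ->
  (profile p S x <= K%:E)%E.
Proof.
move=> p0 K0 H; apply: profile_le => A f f0 fn0 fA Ax; have := H A f f0 fA Ax.
have [d d0 ->] := dirichlet_finsupp S p0 fA.
have [n n0 ->] := lsum_powR_finsupp p0 f0 fn0 fA.
rewrite poweR_ratio ?invr_gt0 // lee_fin; case: eqVneq => [->|dn0].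
  by rewrite mulr0 leNgt n0.
have dp : 0 < d by rewrite lt_def dn0.
rewrite -ler_pdivrMr // lee_fin => nd.
have -> : K = (K `^ p) `^ p^-1 by rewrite -powRrM divff ?powRr1 ?gt_eqF // ltW.
by apply: ge0_ler_powR; rewrite ?nnegrE ?invr_ge0 ?divr_ge0 ?powR_ge0 // ltW.
Qed.

(** Tested on the indicator of a point, whose energy along each generator is at most 2. The lower
    bound on [r] does not depend on [x]. *)
Lemma profile1_gt0 (R : realType) (x r : R) (G : groupType) (S : {fset G}) :
  1 <= x -> 0 <= r -> (profile 1 S x <= r%:E)%E -> 1 <= 2 * #|` S|%:R * r.
Proof.
move=> x1 r0 Hr; pose E := [fset (1 : G)%g]%fset.
have e2 (g : G) : (energy 1 (findic R E) g <= 2%:E)%E.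
  have -> : 2%:E = (lsum (findic R E) + lsum (fun h => findic R E (h * g)%g))%E.
    rewrite -(lsum_reindex (findic R E) (mulg_bij g)).
    by rewrite lsum_findic cardfs1 -EFinD.
  rewrite -lsumD ?findic_ge0 //; try by move=> h; apply: findic_ge0.
  apply: le_lsum => h; rewrite powRr1 //.
  rewrite (le_trans (ler_normB _ _)) // !ger0_norm ?findic_ge0 //.
have : (lsum (findic R E) <= r%:E * dirichlet 1 S (findic R E))%E.
  apply: (lsum_le_of_profile (A := E) r0 Hr); last by rewrite cardfs1.
    by move=> g; apply: findic_ge0.
  by move=> g /negbTE gA; rewrite /findic gA.
rewrite lsum_findic cardfs1 => /le_trans H.
have : (1%:E <= r%:E * (\sum_(s <- S) 2%:E))%E.
  by apply: H; apply: lee_wpmul2l; [rewrite lee_fin|apply: lee_sum].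
rewrite sumEFin big_const_seq count_predT iter_addr_0 -EFinM lee_fin.
by rewrite -(mulr_natr 2) [r * _]mulrC.
Qed.

(** * The upper bound *)

Lemma mul_cursor (H : groupType) (s : finSym H) (h g : H) :
  (Shuffler s h * Shuffler 1%g g)%g = Shuffler s (h * g)%g.
Proof. by congr Shuffler; rewrite /= finSym_act_one mulg1. Qed.

Lemma Shuffler_bij (H : groupType) : bijective (fun z : finSym H * H => Shuffler z.1 z.2).
Proof. by exists (fun a => (shuffler_perm a, shuffler_cursor a)); case. Qed.

Lemma lsum_shuffler (R : realType) (H : groupType) (u : shuffler H -> R) :
  (forall a, 0 <= u a) ->
  lsum u = (\esum_(s in [set: finSym H]) lsum (fun h => u (Shuffler s h)))%E.
Proof. by apply: lsum_pair; apply: Shuffler_bij. Qed.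

(** Right multiplication by [Shuffler 1 g] moves only the cursor, so the inequality on [H] can be
    summed over the permutations. *)
Lemma fibrewise_isoperimetry (R : realType) (H : groupType) (S : {fset H}) (r : R)
    (u : shuffler H -> R) :
  0 <= r -> (forall a, 0 <= u a) ->
  (forall s, (lsum (fun h => u (Shuffler s h)) <=
              r%:E * dirichlet 1 S (fun h => u (Shuffler s h)))%E) ->
  (lsum u <= r%:E * \sum_(g <- S) energy 1 u (Shuffler 1%g g))%E.
Proof.
move=> r0 u0 iso.
have D0 a : 0 <= \sum_(g <- S) `|u a - u (a * Shuffler 1%g g)%g| `^ 1.
  by apply: sumr_ge0 => g _; apply: powR_ge0.
rewrite /energy -lsum_sum; last by move=> *; apply: powR_ge0.
rewrite -lsumZ // [leRHS]lsum_shuffler; last by move=> a; rewrite mulr_ge0.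
rewrite lsum_shuffler //; apply: le_esum => s _; apply: le_trans (iso s) _.
rewrite dirichletE -lsumZ //; last by move=> h; apply: sumr_ge0 => g _; apply: powR_ge0.
apply: le_lsum => h; rewrite ler_wpM2l //; apply: ler_sum => g _.
by rewrite mul_cursor.
Qed.

Lemma energy_findic_ge (R : realType) (G : groupType) (F : {fset G}) (g : G) :
  (((\sum_(a <- F) ((a * g)%g \notin F))%N%:R : R)%:E <= energy 1 (findic R F) g)%E.
Proof.
pose E := [fset a in F | (a * g)%g \notin F]%fset.
rewrite -card_fset_filter -/E -lsum_findic; apply: le_lsum => a.
rewrite powRr1 // /findic !inE /=; case: (a \in F) => /=; last exact: normr_ge0.
by case: ((a * g)%g \in F) => /=; rewrite ?normr_ge0 // subr0 normr1.
Qed.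

Lemma small_fibres (R : realType) (H : groupType) (S : {fset H}) (F : {fset shuffler H})
    (r y : R) : 0 <= r -> 0 <= y ->
  (forall (A : {fset H}) (f : H -> R), (forall h, 0 <= f h) ->
    (forall h, h \notin A -> f h = 0) -> #|` A|%:R <= y ->
    (lsum f <= r%:E * dirichlet 1 S f)%E) ->
  (((\sum_(a <- F) (fibre_card F (shuffler_perm a) < Num.truncn y))%N%:R : R)%:E <=
   r%:E * \sum_(g <- S) energy 1 (findic R F) (Shuffler 1%g g))%E.
Proof.
move=> r0 y0 iso; pose small s := (fibre_card F s < Num.truncn y)%N.
pose Fs := [fset a in F | small (shuffler_perm a)]%fset.
rewrite -(card_fset_filter F (fun a => small (shuffler_perm a))) -/Fs -lsum_findic.
(* Cursor moves preserve the permutation, so keeping only the small fibres of [F] does not increase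
   the energy along them. *)
apply: (@le_trans _ _ (r%:E * \sum_(g <- S) energy 1 (findic R Fs) (Shuffler 1%g g))%E); last first.
  apply: lee_wpmul2l; rewrite ?lee_fin //; apply: lee_sum => g _.
  apply: le_lsum => -[s h]; rewrite !powRr1 // mul_cursor /findic !inE /=.
  by case: (small s); rewrite ?andbT ?andbF // subrr normr0.
apply: fibrewise_isoperimetry => // s.
pose A := [fset shuffler_cursor a | a in [fset a in Fs | shuffler_perm a == s]]%fset.
apply: (iso A) => [h|h hA|]; first exact: findic_ge0.
  rewrite /findic; case: (boolP (_ \in Fs)) => // sF; case/negP: hA.
  by apply/imfsetP; exists (Shuffler s h) => //=; rewrite !inE /= eqxx andbT;
    move: sF; rewrite !inE.
have [->|/fset0Pn[h /imfsetP[a /=]]] := eqVneq A fset0; first by rewrite cardfs0.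
rewrite !inE => /andP[/andP[_ sa] /eqP as_ _].
apply: (@le_trans _ _ (Num.truncn y)%:R); last by rewrite truncn_le.
rewrite ler_nat ltnW //; apply: leq_ltn_trans sa.
apply: (@leq_trans #|` [fset a in Fs | shuffler_perm a == s]%fset|); first exact: leq_imfset_card.
rewrite as_ /fibre_card -(card_fset_filter F (fun a => shuffler_perm a == s)).
by apply: fsubset_leq_card; apply/fsubsetP => b; rewrite !inE => /andP[/andP[-> _] ->].
Qed.

(** If the inequality failed, [F] would have few points in small fibres and few exits by lamp moves,
    and [leq_exp_of_small_boundary] would make it too large. *)
Lemma shuffler_set_isoperimetry (R : realType) (H : groupType) (SH P : {fset H})
    (SL : {fset shuffler H}) (q : nat) :
  generates SL -> #|` P| = (8 * q)%N -> (0 < q)%N ->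
  exists2 M : R, 0 < M & forall r y : R, 0 <= r -> 0 <= y ->
    1 <= 2 * #|` SH|%:R * r ->
    (forall (A : {fset H}) (f : H -> R), (forall h, 0 <= f h) ->
      (forall h, h \notin A -> f h = 0) -> #|` A|%:R <= y ->
      (lsum f <= r%:E * dirichlet 1 SH f)%E) ->
    forall F : {fset shuffler H}, F != fset0 ->
      (#|` F| < q ^ (Num.truncn y %/ 8))%N ->
      ((#|` F|%:R)%:E <= (M * r)%:E * dirichlet 1 SL (findic R F))%E.
Proof.
move=> genL Pq q0.
have [C C0 HC] := sum_energy_le_dirichlet
  ([seq lampmove g | g <- P] ++ [seq Shuffler 1%g g | g <- SH]) id (ltr01 : 0 < 1 :> R) genL.
(* Failure must yield both [16 r C d <= #|F|], for the small fibres, and [16 C d <= #|F|], for the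
   lamp moves. The latter follows from [1 <= 2 * #|SH| * r], whence 32 and the factor [#|SH|]. *)
exists (32 * C * (#|` SH|%:R + 1)); first by rewrite !mulr_gt0 // ltr_wpDl.
move=> r y r0 y0 r1 iso F F0 Fq; rewrite leNgt; apply/negP.
have FA a : a \notin F -> findic R F a = 0 by move=> /negbTE aF; rewrite /findic aF.
have [d d0 dE] := dirichlet_finsupp SL ltr01 FA.
have := HC (findic R F); rewrite dE big_cat !big_map /= -EFinM => Cd.
have sh0 : 0 <= #|` SH|%:R :> R by rewrite ler0n.
rewrite -EFinM lte_fin => lt_F.
have rd0 : 0 <= r * (C * d) by rewrite !mulr_ge0 // ltW.
have Cd0 : 0 <= C * d by rewrite mulr_ge0 // ltW.
have rd : 16 * (r * (C * d)) <= #|` F|%:R.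
  apply: ltW; apply: le_lt_trans lt_F; have : 0 <= #|` SH|%:R * (r * (C * d)) by rewrite mulr_ge0.
  by lra.
have Cd16 : 16 * (C * d) <= #|` F|%:R.
  apply: ltW; apply: le_lt_trans lt_F; have := ler_wpM2r Cd0 r1.
  by lra.
move: Fq; rewrite ltnNge => /negP; apply.
apply: (@leq_exp_of_small_boundary _ F P) => //.
  rewrite -(ler_nat R) natrM; apply: le_trans rd; rewrite ler_wpM2l //.
  rewrite -lee_fin; apply: le_trans (small_fibres F r0 y0 iso) _.
  rewrite EFinM; apply: lee_wpmul2l; rewrite ?lee_fin //; apply: le_trans Cd.
  by rewrite leeDr // sume_ge0 // => *; apply: energy_ge0.
move=> g gP; rewrite -(ler_nat R) natrM; apply: le_trans Cd16; rewrite ler_wpM2l //.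
rewrite -lee_fin; apply: le_trans (energy_findic_ge _ F _) _; apply: le_trans Cd.
rewrite (big_fsetD1 g) //= -addeA leeDl // adde_ge0 // sume_ge0 // => *; exact: energy_ge0.
Qed.

Lemma profile1_finite (R : realType) (G : groupType) (S A : {fset G}) (x : R) :
  (forall g, g \in A) -> #|` A|%:R <= x -> profile 1 S x = +oo%E.
Proof.
move=> AT Ax; have A1 : 1 <= x.
  apply: le_trans Ax; rewrite (ler_nat _ 1) cardfs_gt0.
  by apply/fset0Pn; exists 1%g.
have := profile_ge0 1 S A1; case J : (profile 1 S x) => [r| |] // r0.
have : (lsum (findic R A) <= r%:E * dirichlet 1 S (findic R A))%E.
  apply: (lsum_le_of_profile (A := A) (x := x)) => //; first by rewrite J.
  by move=> g; rewrite AT.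
rewrite /dirichlet big1 => [|s _].
  rewrite mule0 lsum_findic lee_fin (ler_nat _ _ 0) leqn0 cardfs_eq0 => /eqP A0.
  by have := AT 1%g; rewrite A0.
rewrite /energy -(lsum0 R G); apply: eq_lsum => g.
by rewrite /findic !AT subrr normr0 powR0 // oner_eq0.
Qed.

Lemma infinite_fset_card (T : choiceType) (n : nat) : infinite_set [set: T]%classic ->
  exists A : {fset T}, #|` A| = n.
Proof.
move=> /(infinite_set_fset n)[B _ nB]; exists [fset x in take n B]%fset.
by rewrite card_fseq undup_id ?take_uniq // size_take_min; apply/minn_idPl.
Qed.

(** With [k] the integer part of [ln x] and [j = k %/ 8 >= 1], one has
    [ln x < k + 1 <= 8 j + 8 <= 17 j]. *)
Lemma ltr_exp_truncn_ln (R : realType) (q : nat) (x : R) :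
  expR 17 <= q%:R :> R -> expR 8 <= x -> x < q%:R ^+ (Num.truncn (ln x) %/ 8).
Proof.
move=> qe x8; have x0 : 0 < x by apply: lt_le_trans x8; apply: expR_gt0.
have y8 : 8 <= ln x by rewrite -[8]expRK ler_ln ?posrE ?expR_gt0.
have y0 : 0 <= ln x by apply: le_trans y8.
have /andP[ky yk] := truncn_itv y0; set k := Num.truncn (ln x) in ky yk *.
have k8 : (8 <= k)%N by rewrite truncn_ge_nat.
have m1 : (8 * (k %/ 8) + 8 <= 17 * (k %/ 8))%N by lia.
have mk : (k.+1 <= 8 * (k %/ 8) + 8)%N by lia.
apply: (@lt_le_trans _ _ (expR 17 ^+ (k %/ 8))); last first.
  by apply: lerXn2r; rewrite ?nnegrE ?expR_ge0.
rewrite -expRM_natr -{1}[x]lnK ?posrE // ltr_expR (lt_le_trans yk) //.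
by rewrite -natrM ler_nat (leq_trans mk).
Qed.

Lemma shuffler_profile_upper (R : realType) (p : R) (H : groupType)
    (SH : {fset H}) (SL : {fset shuffler H}) :
  1 <= p -> generates SL ->
  preceq (profile p SL) (fun x : R => profile 1 SH (ln x)).
Proof.
move=> p1 genL; have p0 : 0 < p by apply: lt_le_trans p1.
(* If [H] is finite, its indicator has zero gradient, so the right-hand side is [+oo] once
   [ln x >= #|H|]. Otherwise [H] contains a set [P] of [8 q] elements. *)
exists 1 => //; case: (pselect (finite_set [set: H]%classic)) => [/finite_fsetP[A AT]|Hinf].
  exists 1 => //; near=> x; rewrite mul1r (@profile1_finite _ _ _ A) ?mul1e ?leey //.
    by move=> g; have : [set: H]%classic g by []; rewrite AT.
  have x1 : expR #|` A|%:R <= x by near: x; apply: nbhs_pinfty_ge; rewrite num_real.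
  by rewrite -[leLHS]expRK ler_ln ?posrE ?expR_gt0 // (lt_le_trans _ x1) ?expR_gt0.
pose q := Num.bound (expR 17 : R).
have qe : expR 17 <= q%:R :> R by rewrite ltW // archi_boundP // expR_ge0.
have q0 : (0 < q)%N by rewrite -(ltr_nat R) (lt_le_trans _ qe) // expR_gt0.
have [P Pq] := infinite_fset_card (8 * q) Hinf.
have [M M0 HM] := shuffler_set_isoperimetry R SH genL Pq q0.
have [c c0 Hc] := lp_isoperimetry SL p1.
exists (c * M); first exact: mulr_gt0.
near=> x; rewrite mul1r.
have x8 : expR 8 <= x by near: x; apply: nbhs_pinfty_ge; rewrite num_real.
have x0 : 0 < x by apply: lt_le_trans x8; apply: expR_gt0.
have y8 : 8 <= ln x by rewrite -[8]expRK ler_ln ?posrE ?expR_gt0.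
have y1 : 1 <= ln x by apply: le_trans y8; rewrite ler1n.
have x1 : 1 <= x by rewrite (le_trans _ x8) // -expR0 ler_expR.
rewrite gee0_abs ?profile_ge0 // gee0_abs ?profile_ge0 //.
have := profile_ge0 1 SH y1; case J : (profile 1 SH (ln x)) => [r| |] // r0; last first.
  by rewrite gt0_muley ?leey // lte_fin mulr_gt0.
have Jr : (profile 1 SH (ln x) <= r%:E)%E by rewrite J.
have r1 := profile1_gt0 y1 r0 Jr.
have rgt0 : 0 < r.
  rewrite lt_def -lee_fin r0 andbT; apply: contraTneq r1 => ->.
  by rewrite mulr0 leNgt ltr01.
rewrite -EFinM -mulrA; apply: profile_le_of_lsum => //; first by rewrite !mulr_gt0.
move=> A f f0 fA Ax; apply: (Hc (M * r) A) => //; first exact: mulr_gt0.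
(* Only sets of at most [#|A| <= x] elements occur, and [x] is below the exponential lower bound, so
   the isoperimetric inequality holds for all of them. *)
move=> u u0 uA; apply: (@l1_isoperimetry _ _ SL (M * r) #|` A| _ _ A) => //.
  by rewrite mulr_ge0 // ltW.
move=> F F0 FA; apply: (HM r (ln x)) => //.
- by rewrite (le_trans _ y1).
- by move=> B g g0 gB By; apply: (lsum_le_of_profile (A := B) (x := ln x)).
rewrite -(ltr_nat R) natrX (le_lt_trans _ (ltr_exp_truncn_ln qe x8)) //.
by apply: le_trans Ax; rewrite ler_nat.
Unshelve. all: by end_near.
Qed.

(** * The lower bound *)

Lemma cardfsM (T U : choiceType) (A : {fset T}) (B : {fset U}) :
  #|` (A `*` B)%fset| = (#|` A| * #|` B|)%N.
Proof.
rewrite (perm_size (enum_imfset2 _ _)) => [|[? ?] [? ?] _ _ [-> ->]] //.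
by rewrite size_allpairs.
Qed.

Definition supported (T : choiceType) (A : {fset T}) (s : finSym T) : Prop :=
  forall x, x \notin A -> s x = x.

Lemma supportedM (T : choiceType) (A : {fset T}) (s t : finSym T) :
  supported A t -> supported A (s * t)%g <-> supported A s.
Proof.
move=> tA; split=> sA x xA; last by rewrite /= tA // sA.
by rewrite -{1}(tA x xA); apply: sA.
Qed.

(** Such a permutation is determined by a map from [A] to [A]. [dec] inverts this encoding, with
    value [1] on maps that encode no permutation. *)
Lemma supported_fset (T : choiceType) (A : {fset T}) :
  exists Q : {fset finSym T}, (forall s, s \in Q <-> supported A s) /\
    (#|` Q| <= #|` A| ^ #|` A|)%N.
Proof.
pose agree (phi : {ffun A -> A}) (s : finSym T) :=
  supported A s /\ forall a : A, s (val a) = val (phi a).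
pose dec phi : finSym T :=
  if pselect (exists s, agree phi s) is left ex then sval (cid ex) else 1%g.
exists [fset s in [seq dec phi | phi <- enum {: {ffun A -> A}}]]%fset; split; last first.
  by rewrite card_fseq (leq_trans (size_undup _)) // size_map -cardE card_ffun -cardfE.
move=> s; rewrite inE /=; split=> [/mapP[phi _ ->]|sA].
  rewrite /dec; case: pselect => // ex; exact: (svalP (cid ex)).1.
have sAA (a : A) : s (val a) \in A.
  (* A value [s a] outside [A] would be fixed by [s], and injectivity would give [s a = a], which is
     in [A]. *)
  apply: contraT => sa; have saE := finSym_inj (sA _ sa).
  by move: sa; rewrite saE (valP a).
pose phi := [ffun a : A => [` sAA a]%fset].
apply/mapP; exists phi; first by rewrite mem_enum.
have ag : agree phi s by split=> // a; rewrite ffunE.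
rewrite /dec; case: pselect => [ex|[]]; last by exists s.
case: cid => t [/= tA tphi]; apply: finSym_ext => x.
case: (boolP (x \in A)) => [xA|xA]; last by rewrite sA // tA.
by have := tphi [` xA]%fset; rewrite ffunE.
Qed.

Lemma supports_in_fset (T : choiceType) (I : eqType) (r : seq I) (s : I -> finSym T) :
  exists P : {fset T}, forall i, i \in r -> supported P (s i).
Proof.
elim: r => [|i r [P HP]]; first by exists fset0.
have [_ fin] := finSymP (s i).
exists (fset_set [set x | s i x <> x]%classic `|` P)%fset => j.
rewrite inE => /predU1P[->|/HP jP] x; rewrite inE negb_or => /andP[xi xP].
  by apply: contrapT => sx; case/negP: xi; rewrite in_fset_set // inE.
exact: jP.
Qed.

Lemma supported_act (H : groupType) (P A : {fset H}) (h : H) (s : finSym H) :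
  supported P s -> (forall g, g \in P -> (h * g)%g \in A) -> supported A (finSym_act h s).
Proof.
move=> sP hA x xA; rewrite /= sP ?mulVKg //.
by apply: contra xA => /hA; rewrite mulVKg.
Qed.

(** * Lifting functions from [H] to the lampshuffler *)

Definition lift_fun (R : realType) (H : groupType) (Q : {fset finSym H}) (f : H -> R)
  (a : shuffler H) : R := findic R Q (shuffler_perm a) * f (shuffler_cursor a).

Lemma powR_findic (R : realType) (p c : R) (T : choiceType) (Q : {fset T}) (x : T) : 0 < p ->
  0 <= c -> (findic R Q x * c) `^ p = c `^ p * findic R Q x.
Proof.
move=> p0 c0; rewrite /findic; case: (x \in Q); rewrite ?mul1r ?mulr1 //.
by rewrite mul0r mulr0 powR0 // gt_eqF.
Qed.

Lemma cursor_perm_bij (H : groupType) : bijective (fun z : H * finSym H => Shuffler z.2 z.1).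
Proof. by exists (fun a => (shuffler_cursor a, shuffler_perm a)); case. Qed.

Lemma lsum_lift (R : realType) (p : R) (H : groupType) (Q : {fset finSym H}) (f : H -> R) :
  0 < p -> (forall h, 0 <= f h) ->
  lsum (fun a => lift_fun Q f a `^ p) = ((#|` Q|%:R)%:E * lsum (fun h => f h `^ p)%R)%E.
Proof.
move=> p0 f0; rewrite (lsum_pair (e := fun h s => Shuffler s h) (cursor_perm_bij H)).
  rewrite -lsumZ //; last by move=> h; apply: powR_ge0.
  apply: eq_esum => h _; rewrite /lift_fun /=.
  under eq_lsum do rewrite powR_findic //.
  by rewrite lsumZ ?powR_ge0 // lsum_findic EFinM muleC.
by move=> a; apply: powR_ge0.
Qed.

(** Wherever [f] is non-zero, the lamp part of [b] acts by a permutation [t] supported in [A], and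
    multiplication by [t] preserves [Q]. Elsewhere only the endpoint contributes, and summing over
    [s] absorbs the translation by [t]. *)
Lemma energy_lift (R : realType) (p : R) (H : groupType) (Q : {fset finSym H}) (A : {fset H})
    (A0 : {fset H}) (f : H -> R) (b : shuffler H) :
  0 < p -> (forall h, h \notin A0 -> f h = 0) -> (forall s, s \in Q <-> supported A s) ->
  (forall h, h \in A0 -> supported A (finSym_act h (shuffler_perm b))) ->
  energy p (lift_fun Q f) b = ((#|` Q|%:R)%:E * energy p f (shuffler_cursor b))%E.
Proof.
move=> p0 fA0 HQ bA; rewrite /energy.
rewrite (lsum_pair (e := fun h s => Shuffler s h) (cursor_perm_bij H)); last first.
  by move=> a; apply: powR_ge0.
rewrite -lsumZ //.
apply: eq_esum => h _; set c := `|f h - _| `^ p.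
have c0 : 0 <= c by apply: powR_ge0.
set t := finSym_act h (shuffler_perm b).
transitivity (lsum (fun s => c * findic R Q (s * t)%g)); last first.
  rewrite lsumZ // -(lsum_reindex (findic R Q) (mulg_bij t)).
  by rewrite lsum_findic EFinM muleC.
(* [Q] is tested at [s * t] for both endpoints: at the initial one either [f h = 0] or membership is
   unchanged. *)
apply: eq_lsum => s; rewrite /c -powR_findic //; congr (_ `^ _).
rewrite -[findic R Q _]ger0_norm // -normrM mulrBr /lift_fun /= -/t; congr (`|_ - _|).
case: (boolP (h \in A0)) => [/bA tA|/fA0 ->]; last by rewrite !mulr0.
congr (_ * _); rewrite /findic; congr (_%:R); congr nat_of_bool.
by apply/idP/idP => /HQ sQ; apply/HQ; move: sQ; rewrite supportedM.
Qed.

Lemma profile_lift (R : realType) (p : R) (H : groupType) (SH : {fset H})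
    (SL : {fset shuffler H}) : 1 <= p -> generates SH ->
  exists2 M : R, 0 < M & exists2 K : nat, (0 < K)%N & forall x y : R,
    (forall n : nat, (0 < n)%N -> n%:R <= y -> (((K * n) ^ (K * n) * n)%N)%:R <= x) ->
    (profile p SH y <= M%:E * profile p SL x)%E.
Proof.
move=> p1 genH; have p0 : 0 < p by apply: lt_le_trans p1.
have pV0 : 0 < p^-1 by rewrite invr_gt0.
have [P HP] := supports_in_fset SL (@shuffler_perm H).
have [C C0 HC] := sum_energy_le_dirichlet SL (@shuffler_cursor H) p0 genH.
exists (C `^ p^-1); first exact: powR_gt0.
(* With [n = #|A0|], the set [A] has at most [K n] elements, [Q] at most [(K n)^(K n)], and the lift
   is supported on [n] times as many. The successor keeps [K] positive when [P] is empty. *)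
exists #|` P|.+1 => // x y Hxy; apply: profile_le => A0 f f0 fn0 fA0 A0y.
pose A := [fset (z.1 * z.2)%g | z in (A0 `*` P)%fset]%fset.
have [Q [HQ cardQ]] := supported_fset A.
have A00 : (0 < #|` A0|)%N.
  case: fn0 => h fh; rewrite cardfs_gt0; apply/fset0Pn; exists h.
  by apply: contraNT fh => /fA0 ->.
have cardA : (#|` A| <= #|` P|.+1 * #|` A0|)%N.
  apply: (@leq_trans #|` (A0 `*` P)%fset|); first exact: leq_imfset_card.
  by rewrite cardfsM mulnC leq_mul2r leqnSn orbT.
pose B := [fset Shuffler z.1 z.2 | z in (Q `*` A0)%fset]%fset.
have Bx : #|` B|%:R <= x.
  apply: le_trans (Hxy _ A00 A0y); rewrite ler_nat.
  apply: (@leq_trans #|` (Q `*` A0)%fset|); first exact: leq_imfset_card.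
  rewrite cardfsM leq_mul2r; apply/orP; right; apply: leq_trans cardQ _.
  have N0 : (0 < #|` P|.+1 * #|` A0|)%N by rewrite muln_gt0.
  apply: (@leq_trans ((#|` P|.+1 * #|` A0|) ^ #|` A|)); last exact: leq_pexp2l.
  by case: #|` A| cardA => // k; rewrite leq_exp2r.
have Q0 : 0 < #|` Q|%:R :> R.
  by rewrite ltr0n cardfs_gt0; apply/fset0Pn; exists 1%g; apply/HQ.
have F0 a : 0 <= lift_fun Q f a by rewrite mulr_ge0 // findic_ge0.
have FB a : a \notin B -> lift_fun Q f a = 0.
  case: a => s h aB; rewrite /lift_fun /= /findic.
  case: (boolP (s \in Q)) => sQ; last by rewrite mul0r.
  rewrite fA0 ?mulr0 //; apply: contra aB => hA; apply/imfsetP; exists (s, h) => //=.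
  by rewrite in_fsetM /= sQ hA.
have Fn0 : exists a, lift_fun Q f a != 0.
  have [h fh] := fn0; exists (Shuffler 1%g h); rewrite /lift_fun /findic /=.
  by rewrite (_ : 1%g \in Q) ?mul1r //; apply/HQ.
apply: (@le_trans _ _ ((C `^ p^-1)%:E * (lsum (fun a => lift_fun Q f a `^ p)%R `^ p^-1 /
   dirichlet p SL (lift_fun Q f) `^ p^-1))%E); last first.
  by apply: lee_wpmul2l; [rewrite lee_fin powR_ge0|apply: le_profile FB Bx].
rewrite lsum_lift //.
have [n n0 nE] := lsum_powR_finsupp p0 f0 fn0 fA0.
have [d d0 dE] := dirichlet_finsupp SH p0 fA0.
have [e e0 eE] := dirichlet_finsupp SL p0 FB.
have ed : e <= #|` Q|%:R * (C * d).
  rewrite -lee_fin -eE [in leRHS]EFinM EFinM -dE.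
  apply: (@le_trans _ _ ((#|` Q|%:R)%:E * \sum_(b <- SL) energy p f (shuffler_cursor b))%E).
    rewrite ge0_sume_distrr; last by move=> *; apply: energy_ge0.
    rewrite /dirichlet !big_seq; apply: lee_sum => b bS.
    rewrite (energy_lift p0 fA0 HQ) // => h hA; apply: supported_act (HP b bS) _.
    by move=> g gP; apply/imfsetP; exists (h, g) => //=; rewrite in_fsetM /= hA gP.
  by apply: lee_wpmul2l.
rewrite nE dE eE -EFinM !poweR_ratio // ?mulr_gt0 //.
have [_|en0] := eqVneq e 0.
  by rewrite gt0_muley ?leey // lte_fin powR_gt0.
have egt0 : 0 < e by rewrite lt_def en0.
have [d_eq0|dn0] := eqVneq d 0; first by move: ed; rewrite d_eq0 !mulr0 leNgt egt0.
have dgt0 : 0 < d by rewrite lt_def dn0.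
rewrite -EFinM lee_fin -powRM ?divr_ge0 ?mulr_ge0 ?(ltW C0) ?(ltW n0) //.
apply: ge0_ler_powR; rewrite ?nnegrE ?mulr_ge0 ?invr_ge0 ?(ltW C0) ?(ltW n0) ?(ltW p0) //.
rewrite ler_pdivrMr // mulrAC mulrA ler_pdivlMr //.
by have := ler_wpM2l (ltW n0) ed; lra.
Qed.

(** * Growth estimates and the lower bound *)

Lemma self_exp_le (R : realType) (x : R) (K n : nat) :
  (0 < K)%N -> (0 < n)%N -> 0 < x -> 1 <= ln (ln x) ->
  n%:R <= ln x / ln (ln x) / (2 * K%:R) ->
  (((K * n) ^ (K * n) * n)%N)%:R <= x.
Proof.
move=> K0 n0 x0; set L := ln x; set l := ln L => l1 nle.
have l0 : 0 < l by apply: lt_le_trans l1.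
have L0 : 0 < L.
  by rewrite ltNge; apply: contraL l0 => L0; rewrite /l ln0 // ltxx.
have K0R : 0 < K%:R :> R by rewrite ltr0n.
set N := (K * n)%N; have N0 : (0 < N)%N by rewrite muln_gt0 K0.
have Nl : 2 * N%:R * l <= L.
  move: nle; rewrite ler_pdivlMr ?mulr_gt0 // ler_pdivlMr // natrM.
  by apply: le_trans; rewrite le_eqVlt; apply/orP; left; apply/eqP; ring.
have NL : N%:R <= L.
  apply: le_trans Nl; have : 0 <= N%:R :> R by []; nra.
have nN : (n <= N ^ N)%N.
  apply: (@leq_trans N); first by rewrite leq_pmull.
  by rewrite -{1}[N]expn1 leq_pexp2l.
(* The last factor [n] is absorbed into a second [N ^ N], which is the reason for the 2 in [2 * K];
   then [N^(2N) = exp(2 N ln N)] with [ln N <= ln (ln x)]. *)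
apply: (@le_trans _ _ ((N ^ N * N ^ N)%N%:R)); first by rewrite ler_nat leq_mul2l nN orbT.
rewrite -expnD natrX -[x]lnK ?posrE // -/L.
have N0R : 0 < N%:R :> R by rewrite ltr0n.
rewrite -[N%:R]lnK ?posrE // -expRM_natr ler_expR; apply: le_trans Nl.
have : ln N%:R <= l by rewrite ler_ln ?posrE.
by move=> /(ler_wpM2l (ltW N0R)); rewrite natrD; lra.
Qed.

(** For [t] the square root of [ln x], [ln (ln x) = 2 ln t < 2 t], so the quotient exceeds
    [t / 2]. *)
Lemma ln_div_lnln_ge (R : realType) (s x : R) : 0 < s -> expR (s ^+ 2) <= x ->
  1 <= ln (ln x) -> s / 2 < ln x / ln (ln x).
Proof.
move=> s0 sx l1; have x0 : 0 < x by apply: lt_le_trans sx; apply: expR_gt0.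
have sL : s ^+ 2 <= ln x by rewrite -[s ^+ 2]expRK ler_ln ?posrE ?expR_gt0.
have L0 : 0 < ln x by apply: lt_le_trans sL; apply: exprn_gt0.
set t := Num.sqrt (ln x); have t2 : t ^+ 2 = ln x by rewrite sqr_sqrtr // ltW.
have t0 : 0 < t by rewrite sqrtr_gt0.
have st : s <= t by rewrite -(ler_pXn2r (n := 2)) ?nnegrE ?t2 // ltW.
rewrite ltr_pdivlMr ?(lt_le_trans _ l1) // -t2 lnXn // -mulr_natr.
by have := ln_sublinear t0; nra.
Qed.

Lemma shuffler_profile_lower (R : realType) (p : R) (H : groupType)
    (SH : {fset H}) (SL : {fset shuffler H}) :
  1 <= p -> generates SH -> assumption_star (profile p SH) ->
  preceq (fun x : R => profile p SH (ln x / ln (ln x))) (profile p SL).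
Proof.
move=> p1 genH star.
have [M M0 [K K0 HK]] := profile_lift SL p1 genH.
have K0R : 0 < 2 * K%:R :> R by rewrite mulr_gt0 // ltr0n.
have [N N0 [B [_ HB]]] := star _ K0R.
exists 1 => //; exists (N * M); first exact: mulr_gt0.
(* Chosen so that [s / 2 = 2 K (|B| + 1)]: then [y] exceeds both 1 and the threshold [B] beyond
   which Assumption (star), with factor [2 K], gives its bound. *)
pose s := 2 * (2 * K%:R) * (`|B| + 1).
have B1 : 0 < `|B| + 1 by rewrite ltr_wpDl.
have s0 : 0 < s by rewrite !mulr_gt0 ?ltr0n.
near=> x; rewrite mul1r.
have xs : expR (s ^+ 2) <= x by near: x; apply: nbhs_pinfty_ge; rewrite num_real.
have xe : expR (expR 1) <= x by near: x; apply: nbhs_pinfty_ge; rewrite num_real.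
have x0 : 0 < x by apply: lt_le_trans xe; apply: expR_gt0.
have x1 : 1 <= x by rewrite (le_trans _ xe) // -expR0 ler_expR expR_ge0.
have Le : expR 1 <= ln x by rewrite -[expR 1]expRK ler_ln ?posrE ?expR_gt0.
have l1 : 1 <= ln (ln x).
  by rewrite -[1]expRK ler_ln ?posrE ?expR_gt0 // (lt_le_trans _ Le) ?expR_gt0.
set y := ln x / ln (ln x) / (2 * K%:R).
have By : `|B| + 1 < y.
  rewrite /y ltr_pdivlMr // (le_lt_trans _ (ln_div_lnln_ge s0 xs l1)) //.
  by rewrite /s; lra.
have y1 : 1 <= y by rewrite ltW // (le_lt_trans _ By) // lerDr.
have {}HB := HB y (le_lt_trans (ler_norm B) (lt_trans _ By)).
have yE : 2 * K%:R * y = ln x / ln (ln x) by rewrite mulrC mulfVK // gt_eqF.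
rewrite -yE; apply: le_trans (HB _) _; first by rewrite ltrDl.
rewrite EFinM -muleA gee0_abs ?profile_ge0 // gee0_abs ?profile_ge0 //.
apply: lee_wpmul2l; first by rewrite lee_fin ltW.
apply: HK => n n0 ny; exact: self_exp_le ny.
Unshelve. all: by end_near.
Qed.

Theorem theoremA (R : realType) (p : R) (H : groupType)
    (SH : {fset H}) (SL : {fset shuffler H}) :
  1 <= p ->
  generates SH ->
  amenable R H ->
  assumption_star (profile p SH) ->
  generates SL ->
  preceq (fun x : R => profile p SH (ln x / ln (ln x))) (profile p SL) /\
  preceq (profile p SL) (fun x : R => profile 1 SH (ln x)).
Proof.
move=> p1 genH _ star genL; split; last exact: shuffler_profile_upper.
exact: shuffler_profile_lower.
Qed.
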